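(* For every superpartition $\Lambda$ of total degree $|\Lambda|$, $$\Omega_{q,t}\,P_\Lambda(q,t)=(qt^{-1})^{|\Lambda|}\,Q_{\Lambda'}(t^{-1},q^{-1}),$$ where $Q_\Lambda(q,t)=b_\Lambda(q,t)P_\Lambda(q,t)$ with $b_\Lambda(q,t)=\langle\!\langle P_\Lambda(q,t)|P_\Lambda(q,t)\rangle\!\rangle_{q,t}^{-1}$, and $Q_{\Lambda'}(t^{-1},q^{-1})$ denotes $Q_{\Lambda'}$ with the parameters $(q,t)$ replaced by $(t^{-1},q^{-1})$.
   Context: $\mathscr R$ is the algebra of symmetric superpolynomials in infinitely many commuting $x_i$ and anticommuting $\theta_i$ over $\mathbb{Q}(q,t)$; it is generated by the power sums $p_r=\sum_ix_i^r$ ($r\ge1$) and $\tilde p_k=\sum_i\theta_ix_i^k$ ($k\ge0$), the $\tilde p_k$ anticommuting. Superpartition of fermionic degree $m$: $\Lambda=(\Lambda^a;\Lambda^s)=(\Lambda_1,\dots,\Lambda_m;\Lambda_{m+1},\dots)$, $\Lambda_1>\dots>\Lambda_m\ge0$, $\Lambda^s$ a partition; $|\Lambda|=\sum\Lambda_i$. $\Lambda^*$ = decreasing rearrangement of all entries; $\Lambda^\circledast$ = decreasing rearrangement of $\Lambda_1+1,\dots,\Lambda_m+1$ and parts of $\Lambda^s$; $\Lambda$ is determined by the pair $(\Lambda^\circledast,\Lambda^* )$, and its conjugate $\Lambda'$ is the superpartition with $(\Lambda')^\circledast=(\Lambda^\circledast)'$ and $(\Lambda')^*=(\Lambda^* )'$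 (usual partition conjugation). Dominance on superpartitions: $\Omega\le\Lambda$ iff same degree, $\Omega^*\le\Lambda^*$, $\Omega^\circledast\le\Lambda^\circledast$. $m_\Lambda$: monomial symmetric superpolynomial $\sum'_\sigma\mathcal K_\sigma(\theta_1\cdots\theta_mx_1^{\Lambda_1}x_2^{\Lambda_2}\cdots)$. $p_\Lambda=\tilde p_{\Lambda_1}\cdots\tilde p_{\Lambda_m}p_{\Lambda_{m+1}}\cdots$; the bilinear scalar product $\langle\!\langle p_\Lambda|p_\Omega\rangle\!\rangle_{q,t}=(-1)^{\binom m2}z_{\Lambda^s}q^{|\Lambda^a|}\prod_{i}\frac{1-q^{\Lambda^s_i}}{1-t^{\Lambda^s_i}}\delta_{\Lambda\Omega}$ with $z_\lambda=\prod_ii^{n_\lambda(i)}n_\lambda(i)!$. $P_\Lambda(q,t)$ is the unique family with $P_\Lambda=m_\Lambda+\sum_{\Omega<\Lambda}c_{\Lambda\Omega}m_\Omega$ and $\langle\!\langle P_\Lambda|P_\Omega\rangle\!\rangle_{q,t}=0$ for $\Lambda\ne\Omega$ (Macdonald superpolynomials). $\Omega_{q,t}$ is the algebra automorphism of $\mathscr R$ given by $\Omega_{q,t}p_r=(-1)^{r-1}\frac{1-q^r}{1-t^r}p_r$ and $\Omega_{q,t}\tilde p_r=(-1)^rq^r\tilde p_r$. *)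

(* Defs.v *)
From HB Require Import structures.
From mathcomp Require Import all_boot all_order all_algebra all_fingroup.
Set Implicit Arguments. Unset Strict Implicit. Unset Printing Implicit Defensive.
Import Order.TTheory GRing.Theory Num.Theory.
Local Open Scope ring_scope.

Definition spart := (seq nat * seq nat)%type.

Definition is_spart (L : spart) : bool :=
  [&& sorted (fun x y : nat => (y < x)%N) L.1,
      sorted (fun x y : nat => (y <= x)%N) L.2 &
      all (fun x : nat => (0 < x)%N) L.2].

Definition deg (L : spart) : nat := (sumn L.1 + sumn L.2)%N.
Definition fdeg (L : spart) : nat := size L.1.

Fixpoint bseqs (k b : nat) : seq (seq nat) :=
  match k with
  | 0 => [:: [::]]
  | k'.+1 => [::] :: [seq x :: s | x <- iota 0 b, s <- bseqs k' b]
  end.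

Definition sparts (n m : nat) : seq spart :=
  [seq L <- [seq (x, y) | x <- bseqs m n.+1, y <- bseqs n n.+1]
     | [&& is_spart L, deg L == n & fdeg L == m]].

Definition star (L : spart) : seq nat :=
  sort geq [seq x <- L.1 ++ L.2 | x != 0%N].
Definition circ (L : spart) : seq nat :=
  sort geq ([seq x.+1 | x <- L.1] ++ L.2).

Definition conjp (la : seq nat) : seq nat :=
  [seq count (fun x => (j < x)%N) la | j <- iota 0 (\max_(x <- la) x)].

Definition pdom (mu la : seq nat) : Prop :=
  forall k : nat, (\sum_(i < k) nth 0 mu i <= \sum_(i < k) nth 0 la i)%N.

Definition sdle (O L : spart) : Prop :=
  [/\ deg O = deg L, fdeg O = fdeg L, pdom (star O) (star L) & pdom (circ O) (circ L)].
Definition sdlt (O L : spart) : Prop := sdle O L /\ O <> L.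

(* An element f of R (homogeneous, supported in one component) is given by its
   coefficients f L on the basis p_L = tp_{L_1}...tp_{L_m} p_{L_{m+1}}...   *)

(* Coefficient of the monomial theta_1...theta_m x_1^{O_1} ... x_l^{O_l}
   (O = (O_1,...,O_m;O_{m+1},...,O_l)) in the expansion of p_L in the variables:
   tp_{a_1}...tp_{a_m} = sum_{i} theta_{i_1}...theta_{i_m} x_{i_1}^{a_1}...; the
   theta's give theta_1..theta_m only for i = sigma a permutation, with sign
   sgn(sigma); the bosonic factor p_{s_1}...p_{s_k} = sum_j prod x_{j_l}^{s_l},
   and j must land in the variables 1..l since the s_l are positive. *)
Definition moncoef (O L : spart) : int :=
  let m := size O.1 in
  let k := size L.2 in
  let l := (m + size O.2)%N in
  let w := O.1 ++ O.2 in
  if size L.1 != m then 0 else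
  \sum_(s : 'S_m) \sum_(j : {ffun 'I_k -> 'I_l})
     (-1) ^+ odd_perm s *
     ([forall v : 'I_l,
         ((\sum_(i < m | (s i == v :> nat)) nth 0%N L.1 i)
          + (\sum_(r < k | (j r == v :> nat)) nth 0%N L.2 r))%N == nth 0%N w v] : nat)%:Z.

Section Field.
Variable F : fieldType.

(* coefficient of m_O in f (f = sum_O mcoef O f * m_O): the monomial
   theta_1..theta_m x^O occurs with coefficient 1 in m_O and in no other m_O'. *)
Definition mcoef (O : spart) (f : spart -> F) : F :=
  \sum_(L <- sparts (deg O) (fdeg O)) f L * (moncoef O L)%:~R.

Definition zpart (s : seq nat) : nat :=
  \prod_(i <- undup s) (i ^ count_mem i s * (count_mem i s)`!)%N.

Definition zz (a b : F) (L : spart) : F :=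
  (-1) ^+ 'C(size L.1, 2) * (zpart L.2)%:R * a ^+ sumn L.1
  * \prod_(x <- L.2) ((1 - a ^+ x) / (1 - b ^+ x)).

Definition sprod (a b : F) (n m : nat) (f g : spart -> F) : F :=
  \sum_(L <- sparts n m) f L * g L * zz a b L.

(* Omega_{q,t} acting on p_L (it is multiplicative, so diagonal in this basis) *)
Definition omfac (q t : F) (L : spart) : F :=
  \prod_(x <- L.1) ((-1) ^+ x * q ^+ x)
  * \prod_(x <- L.2) ((-1) ^+ x.-1 * ((1 - q ^+ x) / (1 - t ^+ x))).

Definition omega (q t : F) (f : spart -> F) : spart -> F :=
  fun L => omfac q t L * f L.

Definition macdonald_family (a b : F) (P : spart -> spart -> F) : Prop :=
  [/\ (forall L, is_spart L -> forall G, G \notin sparts (deg L) (fdeg L) -> P L G = 0),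
      (forall L, is_spart L -> mcoef L (P L) = 1),
      (forall L O, is_spart L -> is_spart O -> mcoef O (P L) != 0 -> O = L \/ sdlt O L) &
      (forall L O, is_spart L -> is_spart O -> L <> O -> deg L = deg O -> fdeg L = fdeg O ->
         sprod a b (deg L) (fdeg L) (P L) (P O) = 0)].

End Field.

Definition QQqt : fieldType := {fraction {poly {poly rat}}}.
Definition qq : QQqt := tofrac ('X%:P : {poly {poly rat}}).
Definition tt : QQqt := tofrac ('X : {poly {poly rat}}).

(* Main.v *)
(* Let [h_O] be the basis dual to the monomials [m_O] for the (q,t)-form.  Since
   [P_L] is unitriangular in the monomials, its dual [Q_L] is a unitriangular
   combination of the [h_O] with [O >= L].  On the power-sum basis
   [Omega h_O = e_O] no longer depends on (q,t), and the coefficient of [m_K] in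
   [e_O] is that of [x^O y^K] in the kernel
   [prod (1 + x_i y_j + theta_i phi_j)], i.e. a signed count of pairs (s, A) with
   [s] a permutation and [A] a 0/1 matrix with margins [O], [K] avoiding the graph
   of [s].  Gale-Ryser applied to [A] and to its union with the graph of [s] gives
   [e_O = m_{O'} + lower terms], so [Omega Q_L] is unitriangular with leading term
   [m_{L'}].  It is also orthogonal for the (1/t,1/q)-form, because [Omega]
   transports the (q,t)-form to it up to [(q/t)^n]; hence [Omega Q_L = P'_{L'}]. *)

(* Two points of this outline are reached indirectly. The anticommuting variables never appear:
   extracting the coefficient of [theta_1...theta_m] turns a product of fermionic power sums into an
   alternant, so the kernel identity becomes one between commutative polynomials, with a signed sum
   over permutations. And no extremal 0/1 matrix is constructed: the equality case of Gale-Ryser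
   gives only its uniqueness, so the coefficient of [m_{O'}] in [e_O] is 0 or 1. It is not 0 because
   the matrix of all these coefficients is invertible, its entries are supported below the
   conjugate, and conjugation is a bijection.

   A Macdonald family is known only through its defining properties, so the last equality rests on
   their uniqueness: a unitriangular orthogonal family is determined. Comparing square norms in
   [Omega Q_L = P'_{L'}] shows that the norm of [P'_{L'}] is [(q/t)^n] divided by the norm of [P_L];
   this trades the normalisation of [Q_L] for that of [Q_{L'}] and produces the power of [q/t]. *)
Require Import Defs.
From HB Require Import structures.
From mathcomp Require Import all_boot all_order all_algebra all_fingroup.
From mathcomp Require Import zify ring.
From mathcomp Require Import mpoly.
Import Order.TTheory GRing.Theory Num.Theory.
Local Open Scope ring_scope.
Set Implicit Arguments. Unset Strict Implicit. Unset Printing Implicit Defensive.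

(** * Partitions and dominance *)

Section Partitions.
Local Open Scope nat_scope.
Implicit Types (s : seq nat) (L : spart).

(** This is part [x], counted from 0, of the conjugate partition. It ignores the order of [s], so
    partitions can be compared with unsorted matrix margins. *)
Definition cnt s x := count (fun y => x < y) s.

Lemma cnt_cat s1 s2 x : cnt (s1 ++ s2) x = cnt s1 x + cnt s2 x.
Proof. exact: count_cat. Qed.

Lemma cnt_perm s1 s2 x : perm_eq s1 s2 -> cnt s1 x = cnt s2 x.
Proof. by move/seq.permP; apply. Qed.

Lemma cnt_sort s x : cnt (sort geq s) x = cnt s x.
Proof. by apply: cnt_perm; rewrite perm_sort. Qed.

Lemma sum_cnt k s : \sum_(j < k) cnt s j = \sum_(x <- s) minn x k.
Proof.
elim: s => [|a s IH]; first by rewrite big_nil big1.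
rewrite big_cons -IH /cnt /= big_split /=; congr addn.
elim: k {IH} => [|k IHk]; first by rewrite big_ord0 minn0.
rewrite big_ord_recr /= IHk; lia.
Qed.

Lemma sorted_geq_cons a s : sorted geq (a :: s) -> all (fun y => y <= a) s /\ sorted geq s.
Proof.
move=> /= pa; split; last exact: path_sorted pa.
by have := order_path_min (rev_trans leq_trans) pa.
Qed.

Lemma cnt_eq0 a x s : all (fun y => y <= a) s -> a <= x -> cnt s x = 0.
Proof.
move=> /allP sa ax; apply/eqP; rewrite eqn0Ngt -has_count -all_predC.
by apply/allP=> y /sa /= ya; rewrite -leqNgt (leq_trans ya).
Qed.

(** Both sides say that the box in row [j] and column [x] belongs to the Young diagram. *)
Lemma ltn_nth_cnt s j x : sorted geq s -> (x < nth 0 s j) = (j < cnt s x).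
Proof.
elim: s j => [|a s IH] j; first by rewrite nth_nil.
case/sorted_geq_cons=> sa ss; rewrite /cnt /= -/(cnt s x).
case: (ltnP x a) => xa.
  by case: j => [|j] /=; rewrite ?IH //; lia.
have s0 := cnt_eq0 sa xa; rewrite s0.
by case: j => [|j] /=; rewrite ?IH ?s0; lia.
Qed.

Lemma nth_sort_eq s1 s2 j : (forall x, cnt s1 x = cnt s2 x) ->
  sorted geq s1 -> sorted geq s2 -> nth 0 s1 j = nth 0 s2 j.
Proof.
move=> e s1s s2s; apply/eqP; rewrite eqn_leq.
apply/andP; split; rewrite leqNgt; apply/negP => h.
  by move: (h); rewrite ltn_nth_cnt // e -ltn_nth_cnt // ltnn.
by move: (h); rewrite ltn_nth_cnt // -e -ltn_nth_cnt // ltnn.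
Qed.

Lemma size_pos s : all (fun x => 0 < x) s -> size s = cnt s 0.
Proof. by rewrite all_count => /eqP <-. Qed.

Lemma eq_partition s1 s2 : (forall x, cnt s1 x = cnt s2 x) ->
  sorted geq s1 -> sorted geq s2 ->
  all (fun x => 0 < x) s1 -> all (fun x => 0 < x) s2 -> s1 = s2.
Proof.
move=> e s1s s2s p1 p2; apply: (@eq_from_nth _ 0); first by rewrite !size_pos.
by move=> i _; apply: nth_sort_eq.
Qed.

Lemma geq_total : total geq.
Proof. by move=> x y; apply: leq_total. Qed.

Lemma geq_trans : transitive geq.
Proof. exact: rev_trans leq_trans. Qed.

Lemma le_bigmax s x : x \in s -> x <= \max_(y <- s) y.
Proof. by move=> xs; rewrite (big_rem x xs) leq_maxl. Qed.

Lemma nth_conjp s j : nth 0 (conjp s) j = cnt s j.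
Proof.
rewrite /conjp; case: (ltnP j (\max_(x <- s) x)) => h.
  by rewrite (nth_map 0) ?size_iota // nth_iota.
rewrite nth_default ?size_map ?size_iota //.
apply/esym/(cnt_eq0 _ (leqnn j)); apply/allP => x xs.
exact: leq_trans (le_bigmax xs) h.
Qed.

Lemma leq_cnt s x y : x <= y -> cnt s y <= cnt s x.
Proof. by move=> xy; apply: sub_count => z /=; apply: leq_ltn_trans. Qed.

Lemma sorted_conjp s : sorted geq (conjp s).
Proof.
rewrite /conjp sorted_map.
apply: (sub_sorted _ (iota_sorted _ _)) => i j /= ij; exact: leq_cnt.
Qed.

Lemma conjp_pos s : all (fun x => 0 < x) (conjp s).
Proof.
apply/allP => x /mapP[j]; rewrite mem_iota add0n => /andP[_ jM] ->.
have : exists2 y, y \in s & j < y.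
  apply/hasP; rewrite -[has _ _]negbK -all_predC; apply: contraL jM => /allP h.
  rewrite -leqNgt; elim: s h => [|a s IH] h; first by rewrite big_nil.
  rewrite big_cons geq_max IH ?andbT => [|y ys]; last by apply: h; rewrite inE ys orbT.
  by have := h a (mem_head _ _); rewrite /= -leqNgt.
by move=> h; rewrite -has_count; apply/hasP.
Qed.

Lemma cnt_conjp s x : sorted geq s -> cnt (conjp s) x = nth 0 s x.
Proof.
move=> ss.
have e j : (j < cnt (conjp s) x) = (j < nth 0 s x).
  by rewrite -ltn_nth_cnt ?sorted_conjp // nth_conjp -ltn_nth_cnt.
apply/eqP; rewrite eqn_leq leqNgt e ltnn /=.
by rewrite leqNgt -e ltnn.
Qed.

Lemma conjpK s : sorted geq s -> all (fun x => 0 < x) s -> conjp (conjp s) = s.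
Proof.
move=> ss sp; apply: eq_partition => //; rewrite ?sorted_conjp ?conjp_pos // => x.
by rewrite cnt_conjp ?sorted_conjp // nth_conjp.
Qed.

(** Each of the [j] entries is at most its excess over [k] plus [k]. For sorted [s] the bound is
    attained at [j = cnt s k], see [sum_pref_cnt]. *)
Lemma sum_pref_le k j s :
  \sum_(i < j) nth 0 s i <= \sum_(x <- s) (x - k) + j * k.
Proof.
elim: s j => [|a s IH] j.
  by rewrite big_nil add0n big1 // => i _; rewrite nth_nil.
case: j => [|j]; first by rewrite big_ord0.
rewrite big_ord_recl big_cons /=; apply: leq_trans (leq_add (leqnn a) (IH j)) _; lia.
Qed.

Lemma sum_pref_cnt k s : sorted geq s ->
  \sum_(i < cnt s k) nth 0 s i = \sum_(x <- s) (x - k) + cnt s k * k.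
Proof.
elim: s => [|a s IH]; first by rewrite big_nil /cnt /= big_ord0.
case/sorted_geq_cons=> sa ss; rewrite /cnt /= -/(cnt s k) big_cons.
case: (ltnP k a) => ka.
  by rewrite add1n big_ord_recl /= IH //; lia.
have s0 : \sum_(j <- s) (j - k) = 0.
  rewrite big_seq big1 // => j /(allP sa) ja.
  by apply/eqP; rewrite subn_eq0; apply: leq_trans ja ka.
by rewrite (cnt_eq0 sa ka) big_ord0 s0; lia.
Qed.

Lemma sum_min_sub k s : \sum_(x <- s) minn x k + \sum_(x <- s) (x - k) = sumn s.
Proof.
rewrite -big_split sumnE; apply: eq_bigr => x _ /=; lia.
Qed.

(** Dominance is tested on the prefix of length [cnt a k], where the excess bound is an equality for
    [a] and still an upper bound for [b]. As the totals agree, passing from excesses over [k] to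
    truncations at [k] reverses the inequality; hence conjugation reverses dominance. *)
Lemma pdom_min a b : sorted geq a -> sumn a = sumn b -> pdom a b ->
  forall k, \sum_(x <- b) minn x k <= \sum_(x <- a) minn x k.
Proof.
move=> sa sab ab k; have := ab (cnt a k); rewrite sum_pref_cnt // => h.
have := leq_trans h (sum_pref_le k _ _).
by have := sum_min_sub k a; have := sum_min_sub k b; lia.
Qed.

Lemma sum_pref_conjp k s : \sum_(i < k) nth 0 (conjp s) i = \sum_(x <- s) minn x k.
Proof. by rewrite -sum_cnt; apply: eq_bigr => i _; rewrite nth_conjp. Qed.

Lemma pdom_conjp a b : sorted geq a -> sumn a = sumn b -> pdom a b ->
  pdom (conjp b) (conjp a).
Proof. by move=> sa e ab k; rewrite !sum_pref_conjp; apply: pdom_min. Qed.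

Lemma pdom_trans b a c : pdom a b -> pdom b c -> pdom a c.
Proof. by move=> ab bc k; apply: leq_trans (ab k) (bc k). Qed.

Lemma eq_pref (f g : nat -> nat) : (forall k, \sum_(i < k) f i = \sum_(i < k) g i) ->
  f =1 g.
Proof. by move=> h k; have := h k.+1; rewrite !big_ord_recr /= h => /addnI. Qed.

Lemma eq_partition_nth s1 s2 : nth 0 s1 =1 nth 0 s2 ->
  all (fun x => 0 < x) s1 -> all (fun x => 0 < x) s2 -> s1 = s2.
Proof.
have size_le t1 t2 : nth 0 t1 =1 nth 0 t2 -> all (fun x => 0 < x) t1 -> size t1 <= size t2.
  move=> e p1; rewrite leqNgt; apply/negP => h.
  by have := allP p1 _ (mem_nth 0 h); rewrite e nth_default.
move=> e p1 p2; apply: (@eq_from_nth _ 0) => [|i _ //].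
by apply/eqP; rewrite eqn_leq !size_le // => i; rewrite e.
Qed.

Lemma pdom_anti s1 s2 : all (fun x => 0 < x) s1 -> all (fun x => 0 < x) s2 ->
  pdom s1 s2 -> pdom s2 s1 -> s1 = s2.
Proof.
move=> p1 p2 h1 h2; apply: eq_partition_nth => //.
by apply: eq_pref => k; apply/eqP; rewrite eqn_leq h1 h2.
Qed.

Lemma sumn_conjp s : sumn (conjp s) = sumn s.
Proof.
have pref_all t : \sum_(i < size t) nth 0 t i = sumn t.
  by rewrite sumnE (big_nth 0) big_mkord.
rewrite -pref_all sum_pref_conjp sumnE !big_seq; apply: eq_bigr => x xs.
by rewrite size_map size_iota; apply/minn_idPl/le_bigmax.
Qed.

End Partitions.

(** * Conjugation of superpartitions *)

Section Superpartitions.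
Local Open Scope nat_scope.
Implicit Types (s : seq nat) (L : spart).

Lemma star_sorted L : sorted geq (star L).
Proof. exact/sort_sorted/geq_total. Qed.

Lemma circ_sorted L : sorted geq (circ L).
Proof. exact/sort_sorted/geq_total. Qed.

Lemma star_pos L : all (fun x => 0 < x) (star L).
Proof. by rewrite all_sort; apply/allP => x; rewrite mem_filter lt0n => /andP[]. Qed.

Lemma circ_pos L : is_spart L -> all (fun x => 0 < x) (circ L).
Proof.
by case/and3P=> _ _ p2; rewrite all_sort all_cat p2 andbT; apply/allP => x /mapP[y _ ->].
Qed.

Lemma cnt_star L x : cnt (star L) x = cnt L.1 x + cnt L.2 x.
Proof.
rewrite cnt_sort -cnt_cat /cnt count_filter; apply: eq_count => y /=; lia.
Qed.

Lemma cnt_circ L x : cnt (circ L) x = cnt (star L) x + count_mem x L.1.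
Proof.
rewrite cnt_star cnt_sort cnt_cat addnAC; congr addn.
rewrite /cnt count_map; elim: L.1 => //= a s ->; lia.
Qed.

Lemma sumn_star L : sumn (star L) = deg L.
Proof.
have := sumn_cat L.1 L.2; rewrite /deg => <-.
rewrite /star (perm_sumn (permEl (perm_sort _ _))).
by elim: (L.1 ++ L.2) => //= -[|a] s <-.
Qed.

Lemma sumn_circ L : sumn (circ L) = deg L + fdeg L.
Proof.
rewrite /circ (perm_sumn (permEl (perm_sort _ _))) sumn_cat /deg /fdeg.
rewrite [LHS](_ : _ = sumn L.1 + size L.1 + sumn L.2); last first.
  by congr addn; elim: L.1 => //= a s ->; lia.
by rewrite addnAC.
Qed.

Lemma rev_ltn_trans : transitive (fun x y : nat => y < x).
Proof. by move=> y x z yx zy; apply: ltn_trans zy yx. Qed.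

Lemma sorted_gtn_eq s1 s2 : sorted (fun x y : nat => y < x) s1 ->
  sorted (fun x y : nat => y < x) s2 -> perm_eq s1 s2 -> s1 = s2.
Proof.
apply: sorted_eq; first exact: rev_ltn_trans.
by move=> x y /andP[h1 h2]; have := ltn_trans h1 h2; rewrite ltnn.
Qed.

Lemma sorted_gtn_uniq s : sorted (fun x y : nat => y < x) s -> uniq s.
Proof. by apply: sorted_uniq; [exact: rev_ltn_trans | move=> x; rewrite ltnn]. Qed.

(** At threshold [x] the two shapes differ by the multiplicity of [x] in the fermionic part, which
    is thus recovered; the bosonic part is then what remains of [star]. *)
Lemma spart_inj L1 L2 : is_spart L1 -> is_spart L2 ->
  star L1 = star L2 -> circ L1 = circ L2 -> L1 = L2.
Proof.
move=> /and3P[a1 b1 c1] /and3P[a2 b2 c2] es ec.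
have e1 : L1.1 = L2.1.
  apply: sorted_gtn_eq => //; apply/allP => x _ /=.
  by have := cnt_circ L1 x; rewrite ec es cnt_circ => /addnI ->.
have e2 : L1.2 = L2.2.
  apply: eq_partition => // x.
  by have := cnt_star L1 x; rewrite es cnt_star e1 => /addnI ->.
by case: L1 e1 e2 {a1 b1 c1 es ec} => u v; case: L2 {a2 b2 c2} => w z /= -> ->.
Qed.

(** Together with [interlace_succ] and [interlace_pred]: the boxes of [circ] outside [star] form a
    skew shape with at most one box in each row and in each column. *)
Lemma interlace_le L j : nth 0 (star L) j <= nth 0 (circ L) j.
Proof.
rewrite leqNgt; apply/negP => h.
have : j < cnt (star L) (nth 0 (circ L) j) by rewrite -ltn_nth_cnt ?star_sorted.
move=> h2; have : j < cnt (circ L) (nth 0 (circ L) j) by rewrite cnt_circ; lia.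
by rewrite -ltn_nth_cnt ?circ_sorted // ltnn.
Qed.

Lemma cnt_circ_star x L : cnt (circ L) x.+1 <= cnt (star L) x.
Proof.
rewrite cnt_circ !cnt_star addnAC; apply: leq_add; last exact: leq_cnt.
by rewrite /cnt; elim: L.1 => //= a s; lia.
Qed.

Lemma interlace_succ L j : nth 0 (circ L) j <= (nth 0 (star L) j).+1.
Proof.
rewrite leqNgt; apply/negP => h.
have : j < cnt (circ L) (nth 0 (star L) j).+1 by rewrite -ltn_nth_cnt ?circ_sorted.
move=> h2; have := leq_trans h2 (cnt_circ_star _ _).
by rewrite -ltn_nth_cnt ?star_sorted // ltnn.
Qed.

(** Strict decrease of the fermionic part matters here: each threshold count grows by at most one
    from [star] to [circ]. *)
Lemma interlace_pred L j : is_spart L -> nth 0 (circ L) j.+1 <= nth 0 (star L) j.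
Proof.
case/and3P=> /sorted_gtn_uniq u1 _ _; rewrite leqNgt; apply/negP => h.
have : j.+1 < cnt (circ L) (nth 0 (star L) j) by rewrite -ltn_nth_cnt ?circ_sorted.
rewrite cnt_circ count_uniq_mem //; case: (_ \in _) => h2.
  have : j < cnt (star L) (nth 0 (star L) j) by lia.
  by rewrite -ltn_nth_cnt ?star_sorted // ltnn.
have : j < cnt (star L) (nth 0 (star L) j) by lia.
by rewrite -ltn_nth_cnt ?star_sorted // ltnn.
Qed.

(* The circles of the conjugate sit in the rows where [circ] and [star] differ;
   the remaining rows of length [j] of the conjugate are counted by
   [star_(j-1) - circ_j]. *)
Definition sconj L : spart :=
  let N := (size (circ L)).+1 in
  (rev [seq j <- iota 0 N | nth 0 (circ L) j != nth 0 (star L) j],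
   sort geq (flatten [seq nseq (nth 0 (star L) j - nth 0 (circ L) j.+1) j.+1 | j <- iota 0 N])).

Lemma sconj_spart L : is_spart (sconj L).
Proof.
apply/and3P; split.
- rewrite rev_sorted; exact: (sorted_filter ltn_trans (fun j => nth 0 (circ L) j != nth 0 (star L) j) (iota_ltn_sorted 0 _)).
- exact/sort_sorted/geq_total.
- rewrite all_sort; apply/allP => x /flattenP[s /mapP[j _ ->]].
  by rewrite mem_nseq => /andP[_ /eqP ->].
Qed.

Lemma size_star_circ L : is_spart L -> size (star L) <= size (circ L).
Proof.
move=> Ls; rewrite !size_pos ?star_pos ?circ_pos //.
by rewrite cnt_circ leq_addr.
Qed.

Lemma count_sconj1 L (x : nat) : is_spart L ->
  count_mem x (sconj L).1 = nth 0 (circ L) x - nth 0 (star L) x.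
Proof.
move=> Ls; rewrite count_rev count_uniq_mem ?filter_uniq ?iota_uniq //.
rewrite mem_filter mem_iota add0n.
have := interlace_le L x; have := interlace_succ L x.
case: (ltnP x (size (circ L)).+1) => h; first by case: (nth 0 (circ L) x =P nth 0 (star L) x) => /= e; lia.
have h2 : size (star L) <= x by apply: leq_trans (size_star_circ Ls) (ltnW h).
by rewrite (nth_default 0 (ltnW h)) (nth_default 0 h2).
Qed.

Lemma cnt_sconj2 L x : is_spart L ->
  cnt (sconj L).2 x = \sum_(x <= j < (size (circ L)).+1) (nth 0 (star L) j - nth 0 (circ L) j.+1).
Proof.
move=> Ls; rewrite cnt_sort /cnt count_flatten sumnE big_map.
rewrite (big_map _ predT (fun s => count (fun y => x < y) s)).
have -> : iota 0 (size (circ L)).+1 = index_iota 0 (size (circ L)).+1.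
  by rewrite /index_iota subn0.
under eq_bigr do rewrite count_nseq.
case: (leqP x (size (circ L)).+1) => h.
  rewrite (big_cat_nat (n := x)) //= big_nat big1 ?add0n => [|i /andP[_ ix]]; last by lia.
  by apply: eq_big_nat => i /andP[xi _]; lia.
rewrite [RHS]big_geq ?(ltnW h) // big_nat big1 // => i /andP[_ ix].
by lia.
Qed.

Lemma cnt_count s x : cnt s x = count_mem x.+1 s + cnt s x.+1.
Proof. by rewrite /cnt; elim: s => //= a s ->; lia. Qed.

(** Descending induction on the threshold. From [k+1] down to [k] the count grows by the
    multiplicity of the part [k+1]: [circ_(k+1) - star_(k+1)] fermionic copies and
    [star_k - circ_(k+1)] bosonic ones, in total [star_k - star_(k+1)]. *)
Lemma cnt_star_sconj L x : is_spart L -> cnt (star (sconj L)) x = nth 0 (star L) x.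
Proof.
move=> Ls.
have big k : size (circ L) < k -> cnt (star (sconj L)) k = 0 /\ nth 0 (star L) k = 0.
  move=> h; split; last by rewrite nth_default //; have := size_star_circ Ls; lia.
  rewrite cnt_star cnt_sconj2 // big_geq // addn0.
  apply/eqP; rewrite /cnt eqn0Ngt -has_count; apply/negP => /hasP[y].
  by rewrite mem_rev mem_filter mem_iota; lia.
have step k : cnt (star (sconj L)) k.+1 = nth 0 (star L) k.+1 ->
    cnt (star (sconj L)) k = nth 0 (star L) k.
  have [h h2|h] := leqP k (size (circ L)); last by have [-> ->] := big _ h.
  move: h h2; rewrite -ltnS => h; rewrite !cnt_star [cnt _.1 k]cnt_count count_sconj1 //.
  rewrite !cnt_sconj2 // [in X in _ -> X]big_ltn //.
  by have := interlace_le L k.+1; have := interlace_pred k Ls; lia.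
have [d hd] : exists d, size (circ L) < x + d by exists (size (circ L)).+1; lia.
elim: d x hd => [|d IH] x hd; first by rewrite addn0 in hd; have [-> ->] := big _ hd.
by apply: step; apply: IH; rewrite addSnnS.
Qed.

Lemma star_sconj L : is_spart L -> star (sconj L) = conjp (star L).
Proof.
move=> Ls; apply: eq_partition;
  rewrite ?star_sorted ?sorted_conjp ?star_pos ?conjp_pos // => x.
by rewrite cnt_star_sconj // cnt_conjp ?star_sorted.
Qed.

Lemma circ_sconj L : is_spart L -> circ (sconj L) = conjp (circ L).
Proof.
move=> Ls; apply: eq_partition;
  rewrite ?circ_sorted ?sorted_conjp ?circ_pos ?conjp_pos ?sconj_spart // => x.
rewrite cnt_circ cnt_star_sconj // count_sconj1 // cnt_conjp ?circ_sorted //.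
by rewrite subnKC ?interlace_le.
Qed.

Lemma sconj_unique L G : is_spart L -> is_spart G ->
  circ G = conjp (circ L) -> star G = conjp (star L) -> G = sconj L.
Proof.
move=> Ls Gs ec es.
by apply: spart_inj; rewrite ?sconj_spart // ?star_sconj ?circ_sconj.
Qed.

Lemma sconjK L : is_spart L -> sconj (sconj L) = L.
Proof.
move=> Ls; apply/esym/sconj_unique; rewrite ?sconj_spart //.
  by rewrite circ_sconj // conjpK ?circ_sorted ?circ_pos.
by rewrite star_sconj // conjpK ?star_sorted ?star_pos.
Qed.

Lemma deg_sconj L : is_spart L -> deg (sconj L) = deg L.
Proof. by move=> Ls; rewrite -sumn_star star_sconj // sumn_conjp sumn_star. Qed.

Lemma fdeg_sconj L : is_spart L -> fdeg (sconj L) = fdeg L.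
Proof.
move=> Ls; have := sumn_circ (sconj L).
by rewrite circ_sconj // sumn_conjp sumn_circ deg_sconj // => /addnI.
Qed.

Definition sle (O L : spart) := pdom (star O) (star L) /\ pdom (circ O) (circ L).

Lemma sle_trans L2 L1 L3 : sle L1 L2 -> sle L2 L3 -> sle L1 L3.
Proof.
by move=> [a1 b1] [a2 b2]; split; [exact: pdom_trans a1 a2 | exact: pdom_trans b1 b2].
Qed.

Lemma sle_anti L1 L2 : is_spart L1 -> is_spart L2 -> sle L1 L2 -> sle L2 L1 -> L1 = L2.
Proof.
move=> s1 s2 [a1 b1] [a2 b2]; apply: spart_inj => //.
  by apply: pdom_anti; rewrite ?star_pos.
by apply: pdom_anti; rewrite ?circ_pos.
Qed.

Lemma sle_sconj L1 L2 : is_spart L1 -> is_spart L2 -> deg L1 = deg L2 ->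
  fdeg L1 = fdeg L2 -> sle L1 L2 -> sle (sconj L2) (sconj L1).
Proof.
move=> s1 s2 ed ef [a b]; split; rewrite ?star_sconj ?circ_sconj //.
  by apply: pdom_conjp => //; rewrite ?star_sorted // !sumn_star.
by apply: pdom_conjp => //; rewrite ?circ_sorted // !sumn_circ ed ef.
Qed.

Lemma mem_bseqs k b s : (s \in bseqs k b) = (size s <= k) && all (fun x => x < b) s.
Proof.
elim: k s => [|k IH] [|a s] //=; rewrite inE //=; apply/allpairsP/idP.
  case=> -[x t] /= [xb tb [-> ->]]; move: tb; rewrite IH ltnS => /andP[-> ->].
  by move: xb; rewrite mem_iota /= add0n => ->.
rewrite ltnS => /and3P[h1 h2 h3]; exists (a, s); split => //=.
  by rewrite mem_iota add0n.
by rewrite IH h1.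
Qed.

Lemma uniq_bseqs k b : uniq (bseqs k b).
Proof.
elim: k => [|k IH] //=; apply/andP; split; first by apply/allpairsP => -[[x t]] /= [].
by apply: allpairs_uniq => [||[x t] [y u] _ _ /= [-> ->]] //; rewrite iota_uniq.
Qed.

Lemma size_le_sumn s : all (fun x => 0 < x) s -> size s <= sumn s.
Proof. by elim: s => //= a s IH /andP[a0 /IH]; lia. Qed.

Lemma all_le_sumn s : all (fun x => x < (sumn s).+1) s.
Proof.
elim: s => //= a s IH; rewrite ltnS leq_addr /=; apply: sub_all IH => x; lia.
Qed.

(** The enumeration bounds lose nothing: every entry is at most the degree, and positive parts
    cannot be more numerous than the degree. *)
Lemma mem_sparts L n m : (L \in sparts n m) = [&& is_spart L, deg L == n & fdeg L == m].
Proof.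
rewrite mem_filter; case: (boolP [&& _, _ & _]) => //= /and3P[Ls /eqP dn /eqP fm].
apply/allpairsP; exists L; split; last by case: (L).
  rewrite mem_bseqs -fm leqnn; apply: sub_all (all_le_sumn _) => x /=; rewrite -dn /deg; lia.
case/and3P: Ls => _ _ p2; have := size_le_sumn p2; rewrite mem_bseqs -dn /deg.
by move=> h; rewrite (leq_trans h) ?leq_addl //=;
  apply: sub_all (all_le_sumn _) => x /=; lia.
Qed.

Lemma uniq_sparts n m : uniq (sparts n m).
Proof. by apply/filter_uniq/allpairs_uniq => [||[x t] [y u] _ _ //]; apply: uniq_bseqs. Qed.

End Superpartitions.

(** * 0/1 matrices with prescribed margins *)

Section ZeroOneMatrices.
Local Open Scope nat_scope.
Variables (l l' : nat).
Implicit Types (A : {set 'I_l * 'I_l'}) (r c : seq nat).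

Definition rowsum A i := \sum_(j < l') ((i, j) \in A).
Definition colsum A j := \sum_(i < l) ((i, j) \in A).

Lemma row_restrict_le A i (es : seq 'I_l') : uniq es ->
  \sum_(j <- es) ((i, j) \in A) <= minn (rowsum A i) (size es).
Proof.
move=> ue; rewrite leq_min; apply/andP; split.
  rewrite big_uniq //= /rowsum [X in _ <= X](bigID (mem es)) /=; exact: leq_addr.
by rewrite -sum1_size; apply: leq_sum => j _; case: (_ \in _).
Qed.

Lemma colsum_le A (es : seq 'I_l') : uniq es ->
  \sum_(j <- es) colsum A j <= \sum_i minn (rowsum A i) (size es).
Proof. by move=> ue; rewrite exchange_big; apply: leq_sum => i _; apply: row_restrict_le. Qed.

Lemma seq_ord_map n c : size c = n -> c = [seq nth 0 c (j : 'I_n) | j <- enum 'I_n].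
Proof.
move=> <-; rewrite -[LHS](mkseq_nth 0) /mkseq -val_enum_ord -map_comp.
by apply: eq_map.
Qed.

Lemma sum_seq_ord n c (F : nat -> nat) : size c = n ->
  \sum_(x <- c) F x = \sum_(i < n) F (nth 0 c i).
Proof. by move=> <-; rewrite (big_nth 0) big_mkord. Qed.

Definition margins A r c :=
  (forall i, rowsum A i = nth 0 r i) /\ (forall j, colsum A j = nth 0 c j).

(** The necessity half of Gale-Ryser: a row meets the [k] longest columns in at most [k] boxes, and
    in no more than its own sum. *)
Lemma gale_ryser A r c k : size r = l -> size c = l' -> margins A r c ->
  \sum_(t < k) nth 0 (sort geq c) t <= \sum_(x <- r) minn x k.
Proof.
move=> sr sc [hr hc]; rewrite {1}(seq_ord_map sc) sort_map.
(* [es] lists the column indices by decreasing length, so the prefix sum becomes a sum of column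
   sums over its first [k] members. *)
set es := sort _ _.
have ue : uniq es by rewrite sort_uniq enum_uniq.
have -> : \sum_(t < k) nth 0 [seq nth 0 c (j : 'I_l') | j <- es] t =
          \sum_(j <- take k es) nth 0 c j.
  elim: es {ue} k => [|j es IH] k.
    by rewrite big_nil big1 // => i _; rewrite nth_nil.
  case: k => [|k]; first by rewrite big_ord0 big_nil.
  by rewrite big_ord_recl /= big_cons -IH.
under eq_bigr do rewrite -hc.
apply: leq_trans (colsum_le _ (take_uniq _ ue)) _.
rewrite (sum_seq_ord (fun x => minn x k) sr); apply: leq_sum => i _.
rewrite hr size_take; case: ifP; lia.
Qed.

(* Gale-Ryser equality case: the matrix is forced.  Below the threshold
   [k = cnt c c_j] the [k] longest columns absorb the whole row, and a count in
   column [j] shows that all the rows above the threshold meet it. *)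
Lemma extremal_matrix A r c : size r = l -> size c = l' -> margins A r c ->
  (forall x, cnt c x = nth 0 (sort geq r) x) ->
  forall i j, ((i, j) \in A) = (cnt c (nth 0 c j) < nth 0 r i).
Proof.
move=> sr sc [hr hc] e i j.
have sorted_sort s : sorted geq (sort geq s) by apply/sort_sorted/geq_total.
(* Conjugacy is symmetric: the counts of the row sums are also the sorted column sums. *)
have e' x : cnt r x = nth 0 (sort geq c) x.
  have h y : (y < cnt r x) = (y < nth 0 (sort geq c) x).
    by rewrite ltn_nth_cnt // cnt_sort e ltn_nth_cnt // cnt_sort.
  by apply/eqP; rewrite eqn_leq leqNgt h ltnn leqNgt -h ltnn.
set h := nth 0 c j; set k := cnt c h.
pose S := [seq j' : 'I_l' <- enum 'I_l' | h < nth 0 c j'].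
have uS : uniq S by rewrite filter_uniq ?enum_uniq.
have szS : size S = k.
  by rewrite size_filter /k /cnt [in RHS](seq_ord_map sc) count_map.
have sumS : \sum_(j' <- S) colsum A j' = \sum_i minn (rowsum A i) (size S).
  rewrite szS; under [RHS]eq_bigr do rewrite hr.
  rewrite -(sum_seq_ord (fun x => minn x k) sr) -sum_cnt.
  under [RHS]eq_bigr do rewrite e'.
  rewrite /k -cnt_sort sum_pref_cnt //.
  rewrite (perm_big _ (permEl (perm_sort _ _))) cnt_sort /= big_filter.
  under eq_bigr do rewrite hc.
  rewrite big_enum_cond /= (sum_seq_ord (fun x => x - h) sc).
  rewrite [in X in _ = _ + X](_ : cnt c h = \sum_(i < l') (h < nth 0 c i)); last first.
    by rewrite /cnt -sum1_count -(sum_seq_ord (fun x => h < x) sc) [LHS]big_mkcond.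
  rewrite big_distrl -big_split /= big_mkcond; apply: eq_bigr => a _.
  by case: ltnP; lia.
(* The row bounds add up to the actual total, so each of them is attained. *)
have row_eq (i' : 'I_l) : \sum_(j' <- S) ((i', j') \in A) = minn (rowsum A i') k.
  have leS i0 (_ : true) : \sum_(j' <- S) ((i0, j') \in A) <= minn (rowsum A i0) (size S)
     ?= iff (\sum_(j' <- S) ((i0, j') \in A) == minn (rowsum A i0) (size S)).
    by split=> //; apply: row_restrict_le.
  have [_] := leqif_sum leS.
  rewrite -sumS exchange_big /= eqxx => /esym/forallP/(_ i')/=/eqP.
  by rewrite szS.
have below (i' : 'I_l) : nth 0 r i' <= k -> (i', j) \notin A.
  move=> le_rk; apply/negP => Aij; have := row_eq i'.
  rewrite hr (minn_idPl le_rk) -hr /rowsum big_filter big_enum_cond /=.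
  rewrite [RHS](bigID (fun j' : 'I_l' => h < nth 0 c j')) /=.
  rewrite [X in _ = _ + X](bigD1 j) /= ?ltnn // Aij; lia.
have sub : [set i' | (i', j) \in A] \subset [set i' : 'I_l | k < nth 0 r i'].
  by apply/subsetP => i'; rewrite !inE ltnNge; apply: contraL => /below.
have := subset_leqif_cards sub => -[_].
have -> : #|[set i' | (i', j) \in A]| = h.
  by rewrite /h -hc /colsum -sum1dep_card big_mkcond.
have : #|[set i' : 'I_l | k < nth 0 r i']| <= h.
  rewrite -sum1dep_card big_mkcond /= -(sum_seq_ord (fun x => k < x : nat) sr).
  have -> : \sum_(x <- r) (k < x : nat) = cnt r k by rewrite /cnt -sum1_count [RHS]big_mkcond.
  by rewrite e' leqNgt ltn_nth_cnt // cnt_sort ltnn.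
move=> le1 heq; have := subset_leq_card sub.
have -> : #|[set i' | (i', j) \in A]| = h.
  by rewrite /h -hc /colsum -sum1dep_card big_mkcond.
move=> le2; have : [set i' | (i', j) \in A] == [set i' : 'I_l | k < nth 0 r i'].
  by rewrite -heq eqn_leq le2 le1.
by move/eqP/setP/(_ i); rewrite !inE.
Qed.

End ZeroOneMatrices.

(** * The order-reversing permutation and its sign *)

Section ReversePermutation.

Definition rev_perm m : 'S_m := perm (@rev_ord_inj m).

(** Reversing [m+1] points amounts to reversing [m] points and sending 0 to the last place, which
    adds [m] inversions; this is Pascal's rule for [C(m+1,2)]. The sign is the one built into the
    scalar product. *)
Lemma odd_rev_perm m : odd_perm (rev_perm m) = odd 'C(m, 2).
Proof.
elim: m => [|m IH].
  by rewrite (_ : rev_perm 0 = 1%g) ?odd_perm1 //; apply/permP => -[].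
have -> : rev_perm m.+1 = lift_perm ord0 ord_max (rev_perm m).
  apply/permP => i; rewrite permE; case: (unliftP ord0 i) => [k ->|->]; last first.
    by rewrite lift_perm_id; apply: val_inj; rewrite /= subn1.
  rewrite lift_perm_lift permE; apply: val_inj => /=.
  by rewrite /bump /= leqNgt; have := ltn_ord k; lia.
by rewrite odd_lift_perm IH binS bin1 oddD /= addbC.
Qed.

(** Strict decrease gives [s a <= m-1-a], and both sides have the same sum over [a]. *)
Lemma antitone_rev_perm m (s : 'S_m) :
  (forall a b : 'I_m, (a < b)%N -> (s b < s a)%N) -> s = rev_perm m.
Proof.
move=> anti.
have le_s (a : 'I_m) : (s a <= rev_ord a)%N.
  have h d : forall b : 'I_m, (b = d :> nat) -> (s b + d < m)%N.
    elim: d => [|d IHd] b bd; first by rewrite addn0 ltn_ord.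
    have dm : (d < m)%N by rewrite (ltn_trans _ (ltn_ord b)) // bd.
    have := IHd (Ordinal dm) erefl; have := anti (Ordinal dm) b; rewrite bd /= ltnSn.
    by move/(_ isT); lia.
  by have := h a a erefl; rewrite /=; have := ltn_ord a; lia.
have sumE : (\sum_(a < m) s a = \sum_(a < m) rev_ord a)%N.
  transitivity (\sum_(a < m) a)%N; last exact: (reindex_inj rev_ord_inj).
  by rewrite [RHS](reindex_perm s).
have leif (a : 'I_m) (_ : true) : (s a <= rev_ord a ?= iff (s a == rev_ord a :> nat))%N.
  by split.
have [_] := leqif_sum leif; rewrite sumE eqxx => /esym/forallP eq_s.
by apply/permP => a; apply: val_inj; rewrite permE; apply/eqP/(eq_s a).
Qed.

End ReversePermutation.

(** * 0/1 matrices combined with the graph of a permutation *)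

Section SuperMatrices.
Local Open Scope nat_scope.
Variables (m l l' : nat) (ml : m <= l) (ml' : m <= l').

(* Positions of the factors [theta_a phi_(s a)] among the boxes (i, j). *)
Definition pgraph (s : 'S_m) : {set 'I_l * 'I_l'} :=
  [set (widen_ord ml a, widen_ord ml' (s a)) | a : 'I_m].

(** Left unsorted: the first [m] positions are the ones carrying a [theta], and [pgraph] refers to
    them. *)
Definition entries (L : spart) := L.1 ++ L.2.
Definition circled (L : spart) := map succn L.1 ++ L.2.

Lemma nth_circled L i : nth 0 (circled L) i = nth 0 (entries L) i + (i < size L.1).
Proof.
rewrite /circled /entries !nth_cat size_map.
by case: ltnP => h; rewrite ?addn0 // (nth_map 0) // addn1.
Qed.

Lemma nth_star_entries L i : nth 0 (star L) i = nth 0 (sort geq (entries L)) i.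
Proof.
apply: nth_sort_eq; rewrite ?star_sorted //; last exact/sort_sorted/geq_total.
by move=> x; rewrite cnt_star cnt_sort cnt_cat.
Qed.

Lemma cnt_entries L x : cnt (entries L) x = cnt (star L) x.
Proof. by rewrite cnt_star cnt_cat. Qed.

Lemma cnt_circled L x : cnt (circled L) x = cnt (circ L) x.
Proof. by rewrite [RHS]cnt_sort. Qed.

Lemma sum_min_cnt s1 s2 k : (forall x, cnt s1 x = cnt s2 x) ->
  \sum_(x <- s1) minn x k = \sum_(x <- s2) minn x k.
Proof. by move=> e; rewrite -!sum_cnt; apply: eq_bigr. Qed.

Definition admissible (O L : spart) (s : 'S_m) (A : {set 'I_l * 'I_l'}) :=
  [&& [disjoint A & pgraph s],
      [forall i, rowsum A i == nth 0 (entries O) i] &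
      [forall j, colsum A j == nth 0 (entries L) j]].

Lemma mem_pgraph s i j :
  ((i, j) \in pgraph s) = [exists a, (i == widen_ord ml a) && (j == widen_ord ml' (s a))].
Proof.
apply/imsetP/existsP => [[a _ [-> ->]]|[a /andP[/eqP -> /eqP ->]]]; exists a => //.
by rewrite !eqxx.
Qed.

Lemma rowsum_pgraph s i : rowsum (pgraph s) i = (i < m).
Proof.
rewrite /rowsum; case: (ltnP i m) => h.
  have ei : i = widen_ord ml (Ordinal h) by apply: val_inj.
  rewrite (bigD1 (widen_ord ml' (s (Ordinal h)))) //= big1 => [|j nj].
    by rewrite mem_pgraph; case: existsP => // -[]; exists (Ordinal h); rewrite -ei !eqxx.
  rewrite mem_pgraph; case: existsP => //= -[a /andP[/eqP ia /eqP ja]].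
  have ea : a = Ordinal h by apply: val_inj; rewrite /= ia.
  by rewrite ja ea eqxx in nj.
rewrite big1 // => j _; rewrite mem_pgraph; case: existsP => //= -[a /andP[/eqP ia _]].
by move: h; rewrite ia /= leqNgt ltn_ord.
Qed.

Lemma colsum_pgraph s j : colsum (pgraph s) j = (j < m).
Proof.
rewrite /colsum; case: (ltnP j m) => h.
  pose a0 := (s^-1)%g (Ordinal h).
  have ej : j = widen_ord ml' (s a0) by apply: val_inj; rewrite /= permKV.
  rewrite (bigD1 (widen_ord ml a0)) //= big1 => [|i ni].
    by rewrite mem_pgraph; case: existsP => // -[]; exists a0; rewrite -ej !eqxx.
  rewrite mem_pgraph; case: existsP => //= -[a /andP[/eqP ia /eqP ja]].
  have ea : a = a0.
    by apply: (@perm_inj _ s); apply: val_inj; move/(congr1 val): ja; rewrite ej.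
  by rewrite ia ea eqxx in ni.
rewrite big1 // => i _; rewrite mem_pgraph; case: existsP => //= -[a /andP[_ /eqP ja]].
by move: h; rewrite ja /= leqNgt ltn_ord.
Qed.

(** The graph adds one box to each of the first [m] rows and columns, and disjointness makes the
    counts add. *)
Lemma margins_circled O L s A : fdeg O = m -> fdeg L = m -> admissible O L s A ->
  margins (A :|: pgraph s) (circled O) (circled L).
Proof.
move=> fO fL /and3P[dA /forallP hr /forallP hc].
have inU i j : ((i, j) \in A :|: pgraph s) = ((i, j) \in A) + ((i, j) \in pgraph s) :> nat.
  rewrite inE; have := disjointFr dA (x := (i, j)).
  by case: (_ \in A) => //= ->.
split=> [i|j]; rewrite nth_circled.
  rewrite -(eqP (hr i)) -[size O.1]/(fdeg O) fO -(rowsum_pgraph s) -big_split.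
  exact: eq_bigr.
rewrite -(eqP (hc j)) -[size L.1]/(fdeg L) fL -(colsum_pgraph s) -big_split.
exact: eq_bigr.
Qed.

Lemma margins_entries O L s A : admissible O L s A -> margins A (entries O) (entries L).
Proof.
by case/and3P=> _ /forallP hr /forallP hc; split=> i; apply/eqP.
Qed.

Lemma size_circled L : size (circled L) = size (entries L).
Proof. by rewrite !size_cat size_map. Qed.

Lemma admissible_sle O L s A : is_spart O -> fdeg O = m -> fdeg L = m ->
  size (entries O) = l -> size (entries L) = l' ->
  admissible O L s A -> sle L (sconj O).
Proof.
move=> Os fO fL sO sL adm; split=> k; rewrite ?star_sconj ?circ_sconj // sum_pref_conjp.
  under [X in X <= _]eq_bigr do rewrite nth_star_entries.
  rewrite -(sum_min_cnt k (cnt_entries O)).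
  exact: gale_ryser (margins_entries adm).
rewrite -(sum_min_cnt k (cnt_circled O)).
by apply: gale_ryser (margins_circled fO fL adm); rewrite size_circled.
Qed.

Lemma admissible_extremal O s A : is_spart O -> fdeg O = m ->
  size (entries O) = l -> size (entries (sconj O)) = l' ->
  admissible O (sconj O) s A ->
  s = rev_perm m /\
  A = [set p : 'I_l * 'I_l' | cnt (star (sconj O)) (nth 0 (entries (sconj O)) p.2) < nth 0 (entries O) p.1].
Proof.
move=> Os fO sO sL adm.
have fL : fdeg (sconj O) = m by rewrite fdeg_sconj.
have memA i j : ((i, j) \in A) =
    (cnt (entries (sconj O)) (nth 0 (entries (sconj O)) j) < nth 0 (entries O) i).
  apply: (extremal_matrix sO sL (margins_entries adm)) => x.
  by rewrite cnt_entries star_sconj // cnt_conjp ?star_sorted ?nth_star_entries.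
have memU i j : ((i, j) \in A :|: pgraph s) =
    (cnt (circled (sconj O)) (nth 0 (circled (sconj O)) j) < nth 0 (circled O) i).
  apply: (extremal_matrix _ _ (margins_circled fO fL adm)); rewrite ?size_circled // => x.
  by rewrite cnt_circled circ_sconj // cnt_conjp ?circ_sorted.
split; last by apply/setP => -[i j]; rewrite inE memA cnt_entries.
have nth_anti L (a b : 'I_m) : is_spart L -> fdeg L = m -> a < b ->
    nth 0 (entries L) b < nth 0 (entries L) a.
  case/and3P=> h _ _ fLm ab; rewrite /fdeg in fLm; rewrite !nth_cat fLm !ltn_ord.
  by have := sorted_ltn_nth rev_ltn_trans 0 h; apply; rewrite ?inE ?fLm.
have [dA _ _] := and3P adm.
(* Suppose [a < b] and [s a < s b], and look at the box [(a, s b)]. It is outside [A], since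
   [(a, s a)] is and column [s b] is shorter than column [s a]. It is in the union, since [(b, s b)]
   is and row [a] is longer than row [b]. So it lies on the graph, which is absurd. *)
apply: antitone_rev_perm => a b ab; rewrite ltnNge leq_eqVlt.
apply/negP => /orP[/eqP/val_inj/perm_inj eab|sab]; first by rewrite eab ltnn in ab.
have ga c : (widen_ord ml c, widen_ord ml' (s c)) \in pgraph s by apply/imsetP; exists c.
have nA : (widen_ord ml a, widen_ord ml' (s b)) \notin A.
  have := disjointFl dA (ga a); rewrite !memA => /negbT; rewrite -!leqNgt => h.
  by apply: leq_trans h (leq_cnt _ (ltnW (nth_anti _ _ _ (sconj_spart O) fL sab))).
have : (widen_ord ml a, widen_ord ml' (s b)) \in A :|: pgraph s.
  have : (widen_ord ml b, widen_ord ml' (s b)) \in A :|: pgraph s by rewrite inE ga orbT.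
  rewrite !memU => /leq_trans; apply.
  rewrite !nth_circled -[size O.1]/(fdeg O) fO /= !ltn_ord leq_add2r.
  exact/ltnW/nth_anti.
rewrite inE (negPf nA) mem_pgraph => /existsP[c /andP[/eqP ac /eqP bc]].
have ec : a = c by apply: val_inj; move/(congr1 val): ac.
have ebc : b = c by apply: (@perm_inj _ s); apply: val_inj; move/(congr1 val): bc.
by rewrite ebc ec ltnn in ab.
Qed.

End SuperMatrices.

(** * The Cauchy identity *)

Section ElementaryNewton.
Variables (R : comNzRingType) (I : finType) (u : I -> R).
Implicit Types (p q : {poly R}).

Definition esgen : {poly R} := \prod_i (1 + u i *: 'X).
Definition psum r := \sum_i u i ^+ r.

Lemma coef_mul_1X p a n :
  (p * (1 + a *: 'X))`_n = p`_n + (if n is n'.+1 then a * p`_n' else 0).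
Proof.
rewrite mulrDr mulr1 coefD -scalerAr coefZ coefMX.
by case: n => [|n] //=; rewrite mulr0.
Qed.

(** Dividing by [1 + a X] is multiplying by its geometric series, of which only [n+1] terms reach
    degree [n]. *)
Lemma coef_div_1X p q a n : p * (1 + a *: 'X) = q ->
  p`_n = \sum_(k < n.+1) (- a) ^+ k * q`_(n - k).
Proof.
move=> <-; elim: n => [|n IH]; first by rewrite big_ord_recl big_ord0 coef_mul_1X mul1r !addr0.
rewrite big_ord_recl expr0 mul1r subn0 coef_mul_1X.
under eq_bigr => i _ do rewrite exprS -mulrA subSS.
by rewrite -mulr_sumr -IH mulNr addrK.
Qed.

Lemma deriv_esgen : esgen^`() = \sum_i u i *: \prod_(j | j != i) (1 + u j *: 'X).
Proof.
rewrite /esgen.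
have h (s : seq I) : uniq s -> (\prod_(i <- s) (1 + u i *: 'X))^`() =
    \sum_(i <- s) u i *: \prod_(j <- s | j != i) (1 + u j *: 'X).
  elim: s => [|a s IH] /=; first by rewrite !big_nil derivC.
  case/andP=> na us; rewrite !big_cons derivM IH // derivD derivC derivZ derivX add0r eqxx /=.
  rewrite -scalerAl mul1r; congr (_ + _).
    congr (_ *: _); rewrite [RHS]big_seq_cond [LHS]big_seq; apply: eq_bigl => j.
    by case js: (j \in s) => //=; apply/esym; apply: contraTneq js => ->.
  rewrite mulr_sumr !big_seq; apply: eq_bigr => i si.
  by rewrite big_cons ifT ?scalerAr //; apply: contraNneq na => ->.
by rewrite [LHS](h _ (index_enum_uniq _)).
Qed.

(** The derivative of [prod (1 + u_i X)] is the sum over [i] of [u_i] times the product divided by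
    [1 + u_i X]; each quotient is expanded as a geometric series. *)
Lemma newton n : esgen`_n.+1 *+ n.+1 =
  \sum_(r < n.+1) (-1) ^+ r * psum r.+1 * esgen`_(n - r).
Proof.
rewrite -coef_deriv deriv_esgen coef_sum.
have h i : (\prod_(j | j != i) (1 + u j *: 'X))`_n =
    \sum_(r < n.+1) (- u i) ^+ r * esgen`_(n - r).
  by apply: coef_div_1X; rewrite mulrC /esgen [RHS](bigD1 i).
under eq_bigr => i _ do rewrite coefZ h mulr_sumr.
rewrite exchange_big; apply: eq_bigr => r _ /=.
rewrite /psum mulr_sumr mulr_suml; apply: eq_bigr => i _.
by rewrite (exprNn (u i)) exprS !mulrA (mulrC (u i) ((-1) ^+ r)).
Qed.

End ElementaryNewton.

Lemma scale_sign (R : nzRingType) (A : lalgType R) k (v : A) :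
  (-1) ^+ k *: v = (-1) ^+ k * v.
Proof.
by rewrite -(signr_odd R k) -(signr_odd A k); case: (odd k); rewrite ?expr0 ?expr1 ?scaleN1r ?mulN1r ?scale1r ?mul1r.
Qed.

(** * Elementary symmetric functions in terms of power sums *)

Section PowerSumExpansion.
Variables (F : fieldType) (R : comAlgType F) (I : finType) (u : I -> R).
Hypothesis char0 : forall n, n.+1%:R != 0 :> F.

Definition is_part (s : seq nat) := sorted geq s && all (fun x => (0 < x)%N) s.
Definition parts n := [seq s <- bseqs n n.+1 | is_part s & sumn s == n].

Lemma mem_parts n s : (s \in parts n) = is_part s && (sumn s == n).
Proof.
rewrite mem_filter; case: (boolP (is_part s && (sumn s == n))) => //= /andP[/andP[_ sp] /eqP <-].
by rewrite mem_bseqs size_le_sumn ?all_le_sumn //.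
Qed.

Lemma uniq_parts n : uniq (parts n).
Proof. exact/filter_uniq/uniq_bseqs. Qed.

(** The coefficient of [p_s] in the elementary symmetric function of degree [|s|]: a sign divided by
    [z_s]. *)
Definition pcoef (s : seq nat) : F := \prod_(x <- s) (-1) ^+ x.-1 / (zpart s)%:R.

Definition pprod (s : seq nat) : R := \prod_(x <- s) psum u x.

Lemma zpart_perm s1 s2 : perm_eq s1 s2 -> zpart s1 = zpart s2.
Proof.
move=> e; rewrite /zpart (perm_big (undup s2)); last by rewrite perm_undup //; apply: perm_mem.
by apply: eq_bigr => x _; rewrite (seq.permP e).
Qed.

Lemma zpart_cons r s : zpart (r :: s) = (r * (count_mem r s).+1 * zpart s)%N.
Proof.
have h : zpart s =
    (\prod_(x <- undup (r :: s)) (x ^ count_mem x s * (count_mem x s)`!))%N.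
  rewrite /zpart /=; case: ifP => // rs.
  by rewrite big_cons (count_memPn (negbT rs)) mul1n.
rewrite h /zpart.
have ru : r \in undup (r :: s) by rewrite mem_undup mem_head.
rewrite !(bigD1_seq r ru (undup_uniq _)) /= eqxx add1n factS expnS.
rewrite [in LHS](eq_bigr (fun x => x ^ count_mem x s * (count_mem x s)`!)%N).
  by rewrite mulnACA -mulnA.
by move=> x nx; rewrite eq_sym (negPf nx).
Qed.

Lemma zpart_gt0 s : all (fun x => (0 < x)%N) s -> (0 < zpart s)%N.
Proof.
elim: s => [|a s IH]; first by rewrite /zpart big_nil.
by case/andP=> a0 /IH s0; rewrite zpart_cons !muln_gt0 a0.
Qed.

Lemma natr_neq0 n : (0 < n)%N -> n%:R != 0 :> F.
Proof. by case: n. Qed.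

Lemma pcoef_cons r s : (0 < r)%N -> all (fun x => (0 < x)%N) s ->
  pcoef (r :: s) * (r * (count_mem r s).+1)%:R = (-1) ^+ r.-1 * pcoef s.
Proof.
move=> r0 sp; rewrite /pcoef big_cons zpart_cons !natrM.
move: (natr_neq0 (zpart_gt0 sp)) (natr_neq0 r0) (char0 (count_mem r s)).
move: (_.+1) (zpart s) => k z h1 h2 h3.
rewrite !invfM mulrACA; move: (\prod_(_ <- _) _) => X; field.
by rewrite h1 h2 h3.
Qed.

Lemma sort_geq_perm s1 s2 : perm_eq s1 s2 -> sorted geq s1 -> sort geq s2 = s1.
Proof.
have anti : antisymmetric geq by move=> x y; rewrite andbC => /anti_leq.
move=> e ss; apply: (sorted_eq geq_trans anti) => //.
  exact/sort_sorted/geq_total.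
by rewrite perm_sort perm_sym.
Qed.

Lemma parts_add_part n r : (0 < r <= n)%N ->
  perm_eq [seq sort geq (r :: s) | s <- parts (n - r)%N] [seq s <- parts n | r \in s].
Proof.
case/andP=> r0 rn; apply: uniq_perm.
- rewrite map_inj_in_uniq ?uniq_parts // => s1 s2.
  rewrite !mem_parts => /andP[/andP[o1 _] _] /andP[/andP[o2 _] _] e.
  have : perm_eq (r :: s1) (r :: s2).
    by rewrite -(perm_sort geq) e perm_sort.
  rewrite perm_cons => e12; rewrite -(sort_geq_perm (perm_refl s1) o1).
  by apply: sort_geq_perm; rewrite // perm_sym.
- exact/filter_uniq/uniq_parts.
move=> s; rewrite mem_filter mem_parts; apply/mapP/idP.
  case=> t; rewrite mem_parts => /andP[/andP[_ tp] /eqP st] ->.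
  rewrite mem_sort mem_head /is_part (sort_sorted geq_total) all_sort /=.
  by rewrite r0 tp /= (perm_sumn (permEl (perm_sort _ _))) /= st subnKC.
case/and3P=> rs /andP[so sp] /eqP ss; have e := perm_to_rem rs.
exists (rem r s); last by rewrite (sort_geq_perm e).
rewrite mem_parts /is_part (subseq_sorted geq_trans (rem_subseq _ _)) //=.
move: (sp); rewrite (perm_all _ e) /= => /andP[_ ->] /=.
by have := perm_sumn e; rewrite /= ss => ->; rewrite addKn.
Qed.

Lemma sumn_count n s : (sumn s <= n)%N ->
  sumn s = (\sum_(r < n.+1) r * count_mem (r : nat) s)%N.
Proof.
elim: s => [|a s IH] /= h; first by rewrite big1 // => i _; rewrite muln0.
rewrite IH; last by lia.
under [RHS]eq_bigr => r _ do rewrite mulnDr.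
rewrite big_split /=; congr addn.
have an : (a < n.+1)%N by lia.
rewrite (bigD1 (Ordinal an)) //= eqxx muln1 big1 ?addn0 // => i ni.
rewrite (_ : a == i = false) ?muln0 //; apply/eqP => ai; case/eqP: ni; exact/val_inj.
Qed.

(* Newton's identities determine the [e_n], and removing one part [r] from a
   partition shows that the right-hand side satisfies them. *)
Lemma esym_psum n : (esgen u)`_n = \sum_(s <- parts n) pcoef s *: pprod s.
Proof.
elim/ltn_ind: n => -[|n] IH.
  have -> : parts 0 = [:: [::]] by [].
  rewrite big_seq1 /pcoef /pprod /zpart !big_nil divr1 scale1r.
  rewrite -horner_coef0 /esgen horner_prod big1 // => i _.
  by rewrite !hornerE.
have inj : injective (fun v : R => n.+1%:R *: v).
  by move=> v w /(congr1 (fun v => n.+1%:R^-1 *: v)); rewrite !scalerA mulVf ?scale1r.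
apply: inj; rewrite /= !scaler_nat newton -sumrMnl.
(* The factor [n+1] is the sum of [r] times the multiplicity of [r] in [s]; each [r] then
   contributes through the partition with one part [r] removed. *)
have -> : \sum_(s <- parts n.+1) (pcoef s *: pprod s) *+ n.+1 =
    \sum_(s <- parts n.+1) \sum_(r < n.+2) (pcoef s *: pprod s) *+ (r * count_mem (r : nat) s).
  rewrite !big_seq; apply: eq_bigr => s; rewrite mem_parts => /andP[_ /eqP es].
  by rewrite sumrMnr -sumn_count ?es.
rewrite exchange_big [RHS]big_ord_recl /= [X in _ = X + _]big1 ?add0r => [|s _]; last first.
  by rewrite mulr0n.
apply: eq_bigr => r _; rewrite /bump /= add1n.
rewrite IH; last by rewrite ltnS leq_subr.
rewrite [RHS](bigID (fun s : seq nat => r.+1 \in s)) /= [X in _ = _ + X]big1 ?addr0 => [|s rs]; last first.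
  by rewrite (count_memPn rs) muln0 mulr0n.
rewrite -[RHS]big_filter -(perm_big _ (@parts_add_part n.+1 r.+1 (ltn_ord r))) big_map subSS.
rewrite mulr_sumr !big_seq; apply: eq_bigr => s; rewrite mem_parts => /andP[/andP[_ sp] _].
have ep : perm_eq (sort geq (r.+1 :: s)) (r.+1 :: s) by rewrite perm_sort.
have -> : pcoef (sort geq (r.+1 :: s)) = pcoef (r.+1 :: s).
  by rewrite /pcoef (perm_big _ ep) (zpart_perm ep).
have -> : pprod (sort geq (r.+1 :: s)) = psum u r.+1 * pprod s.
  by rewrite /pprod (perm_big _ ep) big_cons.
rewrite (seq.permP ep) /= eqxx add1n -scaler_nat scalerA mulrC [in RHS]mulrC pcoef_cons //=.
rewrite -scalerAl -[RHS]scalerA scale_sign -[RHS]scalerAr; congr (_ *: _).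
by rewrite mulrC mulrA.
Qed.

End PowerSumExpansion.

(** * The Cauchy identity in fermionic degree [m] *)

Section Cauchy.
Variables (F : fieldType) (R : comAlgType F) (m : nat).
Hypothesis char0 : forall n, n.+1%:R != 0 :> F.

(** The coefficient of [theta_1...theta_m] in the product of the fermionic power sums indexed by
    [a]. *)
Definition altmon l (ml : (m <= l)%N) (x : 'I_l -> R) (a : seq nat) : R :=
  \sum_(s : 'S_m) (-1) ^+ s * \prod_(i < m) x (widen_ord ml (s i)) ^+ nth 0%N a i.

Definition strict n := [seq b <- bseqs m n.+1 | sorted (fun x y : nat => (y < x)%N) b & size b == m].

Lemma mem_strict n b : (b \in strict n) =
  [&& sorted (fun x y : nat => (y < x)%N) b, size b == m & all (fun x => (x < n.+1)%N) b].
Proof.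
rewrite mem_filter mem_bseqs -andbA; case: eqP => [->|_]; rewrite ?andbF //.
by rewrite leqnn.
Qed.

Lemma big_sparts n (f : spart -> R) :
  \sum_(L <- sparts n m) f L =
  \sum_(b <- strict n) if (sumn b <= n)%N then \sum_(s <- parts (n - sumn b)%N) f (b, s) else 0.
Proof.
have e : perm_eq (sparts n m)
    [seq (b, s) | b <- [seq b <- strict n | (sumn b <= n)%N], s <- parts (n - sumn b)%N].
  apply: uniq_perm; first exact: uniq_sparts.
    apply: allpairs_uniq_dep => [|b _|[b s] [b' s'] _ _ [-> ->]] //.
      by apply/filter_uniq/filter_uniq/uniq_bseqs.
    exact: uniq_parts.
  move=> [b s]; rewrite mem_sparts; apply/idP/allpairsPdep.
    case/and3P=> /and3P[/= sb ss ps] /eqP dn /eqP fm.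
    exists b, s; split => //.
      rewrite mem_filter mem_strict sb -fm eqxx /= -dn leq_addr /=.
      by apply: sub_all (all_le_sumn _) => a; rewrite /deg /=; lia.
    by rewrite mem_parts /is_part ss ps -dn /deg /= addKn /=.
  case=> b' [s' []]; rewrite mem_filter mem_strict mem_parts.
  move=> /andP[bn /and3P[sb /eqP fm _]] /andP[/andP[ss ps] /eqP es] [-> ->].
  by rewrite /is_spart /deg /fdeg /= sb ss ps es subnKC // fm !eqxx.
rewrite (perm_big _ e) big_allpairs_dep big_filter big_mkcond.
by apply: eq_bigr => b _; case: ifP.
Qed.

(** An injective map is, in exactly one way, a strictly decreasing sequence composed with a
    permutation: sort the values and send each index to the rank of its value. *)
Lemma sum_injective n (H : {ffun 'I_m -> 'I_n.+1} -> R) :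
  \sum_(a : {ffun 'I_m -> 'I_n.+1} | injectiveb a) H a =
  \sum_(b <- strict n) \sum_(t : 'S_m) H [ffun i => inord (nth 0%N b (t i))].
Proof.
pose h (b : seq nat) (t : 'S_m) : {ffun 'I_m -> 'I_n.+1} := [ffun i => inord (nth 0%N b (t i))].
have hE b t i : b \in strict n -> h b t i = nth 0%N b (t i) :> nat.
  rewrite mem_strict => /and3P[_ /eqP sb /allP ab].
  by rewrite ffunE inordK //; apply: ab; rewrite mem_nth ?sb.
have nth_inj b (i j : 'I_m) : b \in strict n -> nth 0%N b i = nth 0%N b j -> i = j.
  rewrite mem_strict => /and3P[/sorted_gtn_uniq ub /eqP sb _] /eqP.
  by rewrite nth_uniq ?sb // => /eqP /val_inj.
have codomE b t : b \in strict n -> perm_eq b [seq val (h b t i) | i <- enum 'I_m].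
  move=> bs; have := bs; rewrite mem_strict => /and3P[_ /eqP sb _].
  under eq_map do rewrite /= hE //.
  rewrite [X in perm_eq X _](seq_ord_map sb) (map_comp (fun i : 'I_m => nth 0%N b i) t).
  apply/perm_map/uniq_perm; rewrite ?enum_uniq //.
    by rewrite map_inj_uniq ?enum_uniq //; apply: perm_inj.
  move=> i; rewrite mem_enum; apply/esym/mapP; exists ((t^-1)%g i); rewrite ?mem_enum ?permKV //.
rewrite -big_filter -(big_allpairs_dep (r2 := fun=> index_enum _) (h := h)).
apply: perm_big; apply: uniq_perm.
- by rewrite filter_uniq ?index_enum_uniq.
- apply: allpairs_uniq_dep => [|b _|]; rewrite ?index_enum_uniq //; first exact/filter_uniq/uniq_bseqs.
  move=> [b t] [b' t'] /allpairsPdep[b1 [t1 [b1s _ /= [-> ->]]]].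
  case/allpairsPdep=> [b2 [t2 [b2s _ /= [-> ->]]]] eh.
  have eb : b1 = b2.
    apply: sorted_gtn_eq; last first.
    - by apply: perm_trans (codomE _ t1 b1s) _; rewrite perm_sym eh; apply: codomE.
    - by move: b2s; rewrite mem_strict => /andP[].
    - by move: b1s; rewrite mem_strict => /andP[].
  rewrite -eb in b2s eh *; congr existT; apply/permP => i; apply: (nth_inj b1) => //.
  by rewrite -!hE // eh.
move=> a; rewrite mem_filter mem_index_enum andbT; apply/idP/allpairsPdep => [/injectiveP ia|].
  pose b := sort geq [seq val (a i) | i <- enum 'I_m].
  have pb : perm_eq b [seq val (a i) | i <- enum 'I_m] by rewrite perm_sort.
  have ub : uniq b.
    by rewrite sort_uniq map_inj_uniq ?enum_uniq //; apply: inj_comp ia; apply: val_inj.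
  have szb : size b = m by rewrite (perm_size pb) size_map size_enum_ord.
  have mb i : val (a i) \in b by rewrite (perm_mem pb); apply/mapP; exists i; rewrite ?mem_enum.
  have lt i : (index (val (a i)) b < m)%N by rewrite -[X in (_ < X)%N]szb index_mem.
  have inj : injective (fun i => Ordinal (lt i)).
    move=> i j /(congr1 val) /= e; apply: ia; apply: val_inj.
    by rewrite -(nth_index 0%N (mb i)) -(nth_index 0%N (mb j)) e.
  have bs : b \in strict n.
    rewrite mem_strict szb eqxx /=; apply/andP; split; last first.
      by rewrite (perm_all _ pb); apply/allP => z /mapP[i _ ->]; apply: ltn_ord.
    rewrite -[sorted _ b]/(sorted gtn b) gtn_sorted_uniq_geq ub.
    exact/sort_sorted/geq_total.
  exists b, (perm inj); split; rewrite ?mem_index_enum //.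
  by apply/ffunP => i; apply: ord_inj; rewrite hE // permE; apply/esym/(nth_index 0%N (mb i)).
case=> b [t [bs _ ->]]; apply/injectiveP => i j /(congr1 val); rewrite /= !hE //.
by move/(nth_inj _ _ _ bs)/perm_inj.
Qed.

Lemma coef_div_prod n (v : 'I_m -> R) (p q : {poly R}) :
  p * \prod_i (1 + v i *: 'X) = q ->
  p`_n = \sum_(a : {ffun 'I_m -> 'I_n.+1}) (\prod_i (- v i) ^+ a i) *
           (if (\sum_i a i <= n)%N then q`_(n - \sum_i a i) else 0).
Proof.
move=> pq; pose T i := \sum_(k < n.+1) (- v i *: 'X) ^+ k.
(* Truncated geometric series invert the product modulo [X^(n+1)], which is enough for the
   coefficient of [X^n]. *)
have [g gE] : exists g, \prod_i ((1 + v i *: 'X) * T i) = 1 + g * 'X^(n.+1).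
  elim/big_rec: _ => [|i f _ [g ->]]; first by exists 0; rewrite mul0r addr0.
  have -> : (1 + v i *: 'X) * T i = 1 - (- v i) ^+ n.+1 *: 'X^(n.+1).
    have := subrX1 (- v i *: 'X : {poly R}) n.+1; rewrite -/(T i) exprZn scaleNr => h.
    by rewrite -[LHS]opprK -mulNr opprD addrC -h opprB.
  exists (g - (- v i) ^+ n.+1 *: (1 + g * 'X^(n.+1))).
  by rewrite mulrBl mul1r mulrBl -!scalerAl addrA [X in _ - _ *: X]mulrC.
have : (q * \prod_i T i)`_n = p`_n.
  rewrite -pq -mulrA -big_split gE mulrDr mulr1 coefD mulrA coefMXn ltnSn.
  by rewrite addr0.
move=> <-; rewrite /T bigA_distr_bigA mulr_sumr coef_sum; apply: eq_bigr => a _.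
under eq_bigr do rewrite exprZn.
rewrite scaler_prod -expr_sum -scalerAr coefZ coefMXn.
by rewrite ltnNge; case: (_ <= _)%N.
Qed.

Section TwoAlphabets.
Variables (l l' : nat) (ml : (m <= l)%N) (ml' : (m <= l')%N).
Variables (x : 'I_l -> R) (y : 'I_l' -> R).

(** The determinant of [((x_i y_j)^(a_i))]: the term of [det (1 / (1 - x_i y_j))] in which row [i]
    is expanded to order [a_i]. *)
Definition detmon (a : 'I_m -> nat) : R :=
  \sum_(s : 'S_m) (-1) ^+ s * \prod_(i < m) (x (widen_ord ml i) * y (widen_ord ml' (s i))) ^+ a i.

(** Once [x_i^(a_i)] is taken out of each row, rows [i] and [j] coincide. *)
Lemma detmon_rep a i j : i != j -> a i = a j -> detmon a = 0.
Proof.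
move=> ij aij; pose M := \matrix_(i < m, j < m) y (widen_ord ml' j) ^+ a i.
suff -> : detmon a = \prod_(i < m) x (widen_ord ml i) ^+ a i * \det M.
  by rewrite (determinant_alternate ij) ?mulr0 // => k; rewrite !mxE aij.
rewrite /determinant mulr_sumr; apply: eq_bigr => s _.
rewrite mulrCA -big_split /=; congr (_ * _); apply: eq_bigr => k _.
by rewrite mxE exprMn.
Qed.

(** The relative permutation of the two alternants becomes that of the determinant, and the
    remaining one permutes the exponents. *)
Lemma altmon_mul b : altmon ml x b * altmon ml' y b =
  \sum_(t : 'S_m) detmon (fun i => nth 0%N b (t i)).
Proof.
rewrite /altmon big_distrlr /= [RHS](reindex_inj invg_inj) /=; apply: eq_bigr => t _.
rewrite (reindex_inj (mulgI t)) /=; apply: eq_bigr => s _.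
rewrite odd_permM signr_addb mulrACA [X in X * _]mulrA -signr_addb addbb mul1r.
rewrite -big_split /= [in RHS](reindex_inj (@perm_inj _ t)) /=; congr (_ * _).
by apply: eq_bigr => i _; rewrite permK permM exprMn.
Qed.

(* Expanding [1 / ((1 + u) ...)] along the permutation [s] turns the right-hand
   side into [det ((1 + x_i y_j)^-1) * prod (1 + x_i y_j)], and the determinant is
   expanded over strictly decreasing exponents as in the Cauchy-Binet formula. *)
Lemma cauchy n :
  \sum_(L <- sparts n m) ((-1) ^+ sumn L.1 * pcoef F L.2) *:
     ((altmon ml x L.1 * \prod_(r <- L.2) psum x r) *
      (altmon ml' y L.1 * \prod_(r <- L.2) psum y r)) =
  \sum_(s : 'S_m) (-1) ^+ s *
     (\prod_(p | p \notin pgraph ml ml' s) (1 + (x p.1 * y p.2) *: 'X))`_n.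
Proof.
pose u (p : 'I_l * 'I_l') := x p.1 * y p.2.
(* The cofactor of fermionic exponents of total [k]: the sign of [(-u)^a] and the coefficient of the
   full product in the complementary degree. *)
pose W k : R := if (k <= n)%N then (-1) ^+ k * (esgen u)`_(n - k) else 0.
transitivity (\sum_(a : {ffun 'I_m -> 'I_n.+1}) W (\sum_i a i)%N * detmon (fun i => a i)).
  rewrite (bigID (fun a : {ffun 'I_m -> 'I_n.+1} => injectiveb a)) /=.
  rewrite [X in _ = _ + X]big1 ?addr0 => [|a]; last first.
    case/injectivePn=> i [j ij aij].
    by rewrite (@detmon_rep _ i j) ?mulr0 // aij.
  rewrite sum_injective big_sparts !big_seq; apply: eq_bigr => b.
  rewrite mem_strict => /and3P[_ /eqP sb /allP ab].
  have valE (t : 'S_m) i : inord (n' := n) (nth 0%N b (t i)) = nth 0%N b (t i) :> nat.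
    by rewrite inordK //; apply: ab; rewrite mem_nth ?sb.
  have sumE (t : 'S_m) : (\sum_i [ffun i => inord (n' := n) (nth 0%N b (t i))] i = sumn b)%N.
    under eq_bigr do rewrite ffunE valE.
    rewrite sumnE (sum_seq_ord id sb) [RHS](reindex_inj (@perm_inj _ t)) //.
  under [RHS]eq_bigr => t _.
    rewrite sumE; rewrite [X in _ * X](_ : _ = detmon (fun i => nth 0%N b (t i))); last first.
      by apply: eq_bigr => s _; congr (_ * _); apply: eq_bigr => i _; rewrite ffunE valE.
  over.
  rewrite -mulr_sumr -altmon_mul /W; case: ifP => _; last by rewrite mul0r.
  rewrite (esym_psum _ char0) mulrAC -mulrA mulr_sumr mulr_sumr; apply: eq_bigr => s _ /=.
  rewrite -scalerA scale_sign; congr (_ * _); rewrite -scalerAr; congr (_ *: _).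
  rewrite mulrACA; congr (_ * _); rewrite -big_split /pprod; apply: eq_bigr => r _ /=.
  rewrite /psum big_distrlr pair_bigA /=; apply: eq_bigr => p _.
  by rewrite exprMn.
under [RHS]eq_bigr => s _.
  rewrite (@coef_div_prod n (fun i => x (widen_ord ml i) * y (widen_ord ml' (s i))) _ (esgen u)).
    rewrite mulr_sumr; over.
  rewrite /esgen [RHS](bigID (mem (pgraph ml ml' s))) /= mulrC; congr (_ * _).
  rewrite big_imset //= => i j _ _ [e _]; apply: val_inj; exact: e.
rewrite [RHS]exchange_big /=; apply: eq_bigr => a _.
rewrite /detmon mulr_sumr; apply: eq_bigr => s _.
rewrite mulrCA; congr (_ * _).
under [in RHS]eq_bigr do rewrite exprNn.
rewrite big_split /= prodrXr /W; case: ifP => _; rewrite ?mulr0 ?mul0r //.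
by rewrite mulrAC.
Qed.

End TwoAlphabets.
End Cauchy.

(** * Coefficients of the kernel *)

Definition monexp (m k n : nat) (s : 'S_m) (j : {ffun 'I_k -> 'I_n}) (L : spart) (v : 'I_n) :=
  ((\sum_(i < m | (s i == v :> nat)) nth 0%N L.1 i)
   + (\sum_(r < k | (j r == v :> nat)) nth 0%N L.2 r))%N.

Lemma altmon_expand m l (ml : (m <= l)%N) (F : fieldType) (R : comAlgType F) (x : 'I_l -> R) (L : spart) :
  altmon ml x L.1 * \prod_(r <- L.2) psum x r =
  \sum_(q : 'S_m * {ffun 'I_(size L.2) -> 'I_l})
     (-1) ^+ q.1 *: \prod_v x v ^+ monexp q.1 q.2 L v.
Proof.
have -> : \prod_(r <- L.2) psum x r =
    \sum_(j : {ffun 'I_(size L.2) -> 'I_l}) \prod_v x v ^+ (\sum_(r | j r == v :> nat) nth 0%N L.2 r).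
  rewrite (big_nth 0%N) big_mkord /psum bigA_distr_bigA; apply: eq_bigr => j _.
  rewrite (partition_big j predT) //=; apply: eq_bigr => v _.
  by rewrite -prodrXr; apply: eq_bigr => r /eqP ->.
rewrite /altmon big_distrlr /= pair_bigA; apply: eq_bigr => -[s j] _ /=.
rewrite scale_sign -mulrA; congr (_ * _).
rewrite (partition_big (fun i => widen_ord ml (s i)) predT) //= -big_split /=.
apply: eq_bigr => v _; rewrite exprD; congr (_ * _).
by rewrite -prodrXr; apply: eq_bigr => r /eqP ->.
Qed.

Lemma moncoefE m l (O L : spart) : fdeg O = m -> fdeg L = m -> size (entries O) = l ->
  moncoef O L = \sum_(q : 'S_m * {ffun 'I_(size L.2) -> 'I_l})
     (-1) ^+ q.1 * [forall v, monexp q.1 q.2 L v == nth 0%N (entries O) v]%:R.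
Proof.
move=> fO fL; rewrite size_cat /moncoef -[size L.1]/(fdeg L) -[size O.1]/(fdeg O) fL fO eqxx /=.
move=> <-.
rewrite pair_bigA; apply: eq_bigr => -[s j] _ /=; congr (_ * _).
by rewrite -natz.
Qed.

Section KernelCoefficients.
Variables (m l l' : nat) (ml : (m <= l)%N) (ml' : (m <= l')%N) (F : fieldType).
Hypothesis char0 : forall n, n.+1%:R != 0 :> F.

Definition xvar (i : 'I_l) : {mpoly F[l + l']} := 'X_(lshift l' i).
Definition yvar (j : 'I_l') : {mpoly F[l + l']} := 'X_(rshift l j).
(** The coefficient of [x^O y^L], with both alphabets in one polynomial ring. It is used with [l]
    and [l'] equal to the lengths of [O] and [L]. *)
Definition xycoef (O L : spart) (p : {mpoly F[l + l']}) : F :=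
  p@_[multinom (match split k with inl i => nth 0%N (entries O) i
                                 | inr j => nth 0%N (entries L) j end) | k < l + l'].

Lemma xycoef_monomial O L (a : 'I_l -> nat) (b : 'I_l' -> nat) :
  xycoef O L ((\prod_i xvar i ^+ a i) * (\prod_j yvar j ^+ b j)) =
  [forall i, a i == nth 0%N (entries O) i]%:R * [forall j, b j == nth 0%N (entries L) j]%:R.
Proof.
have -> : (\prod_i xvar i ^+ a i) * (\prod_j yvar j ^+ b j) =
    'X_[[multinom (match split k with inl i => a i | inr j => b j end) | k < l + l']].
  rewrite mpolyXE_id big_split_ord /=; congr (_ * _); apply: eq_bigr => i _; rewrite mnmE.
    by rewrite (unsplitK (inl i)).
  by rewrite (unsplitK (inr i)).
rewrite /xycoef mcoeffX -natrM mulnb; congr (_%:R); congr nat_of_bool.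
apply/eqP/andP => [e|[/forallP ea /forallP eb]].
  split; apply/forallP => i; apply/eqP.
    by have /mnmP/(_ (lshift l' i)) := e; rewrite !mnmE (unsplitK (inl i)).
  by have /mnmP/(_ (rshift l i)) := e; rewrite !mnmE (unsplitK (inr i)).
apply/mnmP => k; rewrite !mnmE; case: (split k) => i; [exact/eqP/ea | exact/eqP/eb].
Qed.

Lemma xycoef_power O L G : fdeg O = m -> fdeg L = m -> fdeg G = m ->
  size (entries O) = l -> size (entries L) = l' ->
  xycoef O L ((altmon ml xvar G.1 * \prod_(r <- G.2) psum xvar r) *
              (altmon ml' yvar G.1 * \prod_(r <- G.2) psum yvar r)) =
  (moncoef O G)%:~R * (moncoef L G)%:~R.
Proof.
move=> fO fL fG sO sL; rewrite !altmon_expand big_distrlr pair_bigA /xycoef raddf_sum /=.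
rewrite (moncoefE fO fG sO) (moncoefE fL fG sL) !raddf_sum big_distrlr pair_bigA /=.
apply: eq_bigr => -[q1 q2] _ /=.
rewrite -scalerAl -scalerAr !linearZ /= -/(xycoef O L _) xycoef_monomial.
have sgnF k : ((-1) ^+ k : int)%:~R = (-1) ^+ k :> F by rewrite rmorphXn /= rmorphN1.
have natF k : (k%:R : int)%:~R = k%:R :> F by rewrite rmorph_nat.
by rewrite !intrM !sgnF !natF -!mulrA; congr (_ * _); apply: mulrCA.
Qed.

Lemma xycoef_boxes O L n (s : 'S_m) : is_spart O -> deg O = n -> size (entries O) = l ->
  xycoef O L (\prod_(p | p \notin pgraph ml ml' s) (1 + (xvar p.1 * yvar p.2) *: 'X))`_n =
  \sum_(A : {set 'I_l * 'I_l'}) (admissible ml ml' O L s A)%:R.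
Proof.
move=> Os dO sO; rewrite big_mkcond /=.
(* Weight 0 on the graph lets the product run over all boxes and expand over arbitrary subsets. *)
pose v (p : 'I_l * 'I_l') := if p \notin pgraph ml ml' s then xvar p.1 * yvar p.2 else 0.
rewrite (eq_bigr (fun p => v p *: 'X + 1)) => [|p _]; last first.
  by rewrite /v; case: ifP => _; rewrite ?scale0r ?add0r // addrC.
rewrite bigA_distr coef_sum /xycoef raddf_sum /=; apply: eq_bigr => A _.
rewrite -big_mkcond /= scaler_prod prodr_const coefZ coefXn.
rewrite -/(xycoef O L _).
have -> : \prod_(p in A) v p = if [disjoint A & pgraph ml ml' s] then
    (\prod_i xvar i ^+ rowsum A i) * (\prod_j yvar j ^+ colsum A j) else 0.
  case: ifPn => [dA|/pred0Pn[p /andP[/= pA pg]]]; last first.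
    by rewrite (bigD1 p) //= /v pg mul0r.
  rewrite (eq_bigr (fun p => xvar p.1 * yvar p.2)) => [|p pA]; last first.
    by rewrite /v (disjointFr dA pA).
  rewrite big_split /=; congr (_ * _).
    rewrite (eq_bigr (fun i => \prod_j xvar i ^+ ((i, j) \in A))) => [|i _]; last by rewrite prodrXr.
    by rewrite pair_bigA [LHS]big_mkcond; apply: eq_bigr => -[i j] _ /=; case: (_ \in _).
  rewrite (eq_bigr (fun j => \prod_i yvar j ^+ ((i, j) \in A))) => [|i _]; last by rewrite prodrXr.
  rewrite exchange_big pair_bigA [LHS]big_mkcond.
  by apply: eq_bigr => -[i j] _ /=; case: (_ \in _).
rewrite /admissible; case: ifP => _ /=; last by rewrite mul0r /xycoef mcoeff0.
(* Degree [n] in [X] selects the sets of [n] boxes, in agreement with the row margins, whose sum is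
   [n]. *)
have card_A : (forall i, rowsum A i = nth 0%N (entries O) i) -> n = #|A|.
  move=> hr; rewrite -dO /deg -sumn_cat sumnE (sum_seq_ord id sO).
  under eq_bigr do rewrite -hr.
  rewrite /rowsum pair_bigA -sum1_card [RHS]big_mkcond.
  by apply: eq_bigr => -[i j] _ /=; case: (_ \in _).
case: (n =P #|A|) => nA; first by rewrite mulr1 xycoef_monomial -natrM mulnb.
rewrite mulr0 /xycoef mcoeff0; case: forallP => //= hr; case: nA; apply: card_A => i.
exact/eqP.
Qed.

Lemma kernel_coef O L n : is_spart O -> deg O = n -> fdeg O = m -> fdeg L = m ->
  size (entries O) = l -> size (entries L) = l' ->
  \sum_(G <- sparts n m) ((-1) ^+ sumn G.1 * pcoef F G.2) *
     ((moncoef O G)%:~R * (moncoef L G)%:~R) =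
  \sum_(s : 'S_m) (-1) ^+ s * \sum_(A : {set 'I_l * 'I_l'}) (admissible ml ml' O L s A)%:R.
Proof.
move=> Os dO fO fL sO sL.
have := congr1 (xycoef O L) (cauchy char0 ml ml' xvar yvar n).
rewrite /xycoef !raddf_sum /= -!/(xycoef O L _) => h.
transitivity (\sum_(G <- sparts n m) xycoef O L (((-1) ^+ sumn G.1 * pcoef F G.2) *:
     ((altmon ml xvar G.1 * \prod_(r <- G.2) psum xvar r) *
      (altmon ml' yvar G.1 * \prod_(r <- G.2) psum yvar r)))).
  rewrite !big_seq; apply: eq_bigr => G; rewrite mem_sparts => /and3P[_ _ /eqP fG].
  by rewrite /xycoef linearZ /= -/(xycoef O L _) xycoef_power.
rewrite /xycoef h; apply: eq_bigr => s _.
by rewrite -(xycoef_boxes _ s Os dO sO) -!scale_sign linearZ.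
Qed.

End KernelCoefficients.

(** * Orthogonal unitriangular families *)

Section OrthogonalTriangular.
Variables (F : fieldType) (N : nat) (le : 'I_N -> 'I_N -> Prop) (rk : 'I_N -> nat).
Hypothesis le_rk : forall i j, le i j -> i != j -> (rk i < rk j)%N.
Hypothesis le_tr : forall j i k, le i j -> le j k -> le i k.
Implicit Types (A B C : 'M[F]_N).

Definition unitriangular C :=
  (forall i, C i i = 1) /\ (forall i j, C i j != 0 -> le j i).

Lemma sum_neq0 (I : finType) (f : I -> F) : \sum_i f i != 0 -> exists i, f i != 0.
Proof.
move=> h; apply/existsP; apply: contraR h => /existsPn h.
by rewrite big1 // => i _; apply/eqP; have := h i; rewrite negbK.
Qed.

Lemma rk_ind_down (P : 'I_N -> Prop) :
  (forall i, (forall j, (rk i < rk j)%N -> P j) -> P i) -> forall i, P i.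
Proof.
move=> h i; have [b hb] : exists b, (\max_j rk j <= rk i + b)%N.
  by exists (\max_j rk j)%N; rewrite leq_addl.
elim: b i hb => [|b IH] i hb; apply: h => j ij.
  by have := leq_bigmax (F := rk) j; lia.
by apply: IH; lia.
Qed.

Lemma le_antisym i j : le i j -> le j i -> i = j.
Proof.
move=> ij ji; apply/eqP; apply/negPn/negP => nij.
by have := le_rk ij nij; have := le_rk ji; rewrite eq_sym => /(_ nij); lia.
Qed.

(** Induction from high rank down: [(v C)_j] is [v_j] plus terms [v_i C_ij] with [i] strictly above
    [j]. If it vanishes while [v_j] does not, some such [v_i] is nonzero, and [P] descends from [i]
    to [j]. *)
Lemma unitriangular_support C (v : 'rV_N) (P : 'I_N -> Prop) :
  unitriangular C -> (forall i j, le j i -> P i -> P j) ->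
  (forall j, (v *m C) 0 j != 0 -> P j) -> forall j, v 0 j != 0 -> P j.
Proof.
move=> [C1 Cle] Pdown hv; apply: rk_ind_down => j IH vj.
have [/eqP vC|] := boolP ((v *m C) 0 j == 0); last exact: hv.
have : \sum_(i | i != j) v 0 i * C i j != 0.
  apply: contraNneq vj => e; move: vC; rewrite mxE (bigD1 j) //= e C1 mulr1 addr0.
  by move=> ->.
rewrite big_mkcond => /sum_neq0[i]; case: ifPn => [nij|]; last by rewrite eqxx.
rewrite mulf_eq0 negb_or => /andP[vi /Cle ji].
by apply: (Pdown i) => //; apply: IH => //; apply: le_rk => //; rewrite eq_sym.
Qed.

Lemma unitriangular_unit C : unitriangular C -> C \in unitmx.
Proof.
move=> uC; rewrite -row_free_unit; apply: inj_row_free => v v0.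
apply/rowP => j; rewrite mxE; apply/eqP/negPn/negP.
by apply: (unitriangular_support (P := fun=> False) uC) => // k; rewrite v0 mxE eqxx.
Qed.

Lemma triangular_quotient A B C : unitriangular A -> unitriangular B ->
  C *m B = A -> forall i j, C i j != 0 -> le j i.
Proof.
move=> [_ Ale] uB e i j Cij.
have := @unitriangular_support B (row i C) (fun j => le j i) uB.
apply=> [k1 k2|k|]; first exact: le_tr.
  by rewrite -row_mul e mxE; apply: Ale.
by rewrite mxE.
Qed.

Lemma diag_inv (d : 'rV[F]_N) : (forall j, d 0 j != 0) ->
  diag_mx d *m diag_mx (map_mx GRing.inv d) = 1%:M.
Proof.
move=> h; rewrite mulmx_diag -diag_const_mx; congr diag_mx.
by apply/rowP => j; rewrite !mxE divff.
Qed.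

Lemma diag_unit (d : 'rV[F]_N) : diag_mx d \in unitmx -> forall j, d 0 j != 0.
Proof.
rewrite unitmxE det_diag unitfE => /prodf_neq0 h j; exact: h.
Qed.

Variable M : 'M[F]_N.

(** As in Gram-Schmidt, the transition matrix [U] and its inverse [V] are triangular in the same
    sense. Orthogonality relates [U] to the transpose of [V], so [U] is diagonal, and the unit
    diagonals make it the identity. *)
Lemma orthogonal_triangular_unique A B (D a b : 'rV[F]_N) :
  unitriangular (A *m M^T) -> unitriangular (B *m M^T) ->
  A *m diag_mx D *m A^T = diag_mx a -> B *m diag_mx D *m B^T = diag_mx b ->
  (forall j, b 0 j != 0) -> A = B.
Proof.
move=> uA uB oA oB b0.
have [Au Mu] : A \in unitmx /\ M^T \in unitmx.
  by have := unitriangular_unit uA; rewrite unitmx_mul => /andP[].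
have Bu : B \in unitmx by have := unitriangular_unit uB; rewrite unitmx_mul => /andP[].
pose U := A *m invmx B; pose V := B *m invmx A.
have UB : U *m B = A by rewrite mulmxKV.
have VA : V *m A = B by rewrite mulmxKV.
clearbody U V.
have lU := triangular_quotient uA uB (C := U); rewrite mulmxA UB in lU.
have lV := triangular_quotient uB uA (C := V); rewrite mulmxA VA in lV.
have e : U *m diag_mx b = diag_mx a *m V^T.
  by rewrite -oB -oA -[RHS]mulmxA -trmx_mul VA !mulmxA UB.
have Udiag i j : U i j != 0 -> i = j.
  move=> Uij; apply: le_antisym; last exact: (lU erefl).
  apply: (lV erefl); have /matrixP/(_ i j) := e; rewrite mul_mx_diag mul_diag_mx !mxE => h.
  have : a 0 i * V j i != 0 by rewrite -h mulf_neq0.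
  by rewrite mulf_eq0 negb_or => /andP[].
have U1 : U = 1%:M.
  apply/matrixP => i j; rewrite mxE; case: (i =P j) => [<-|nij]; last first.
    by apply/eqP/negPn/negP => /Udiag.
  have := uA.1 i; rewrite -UB -mulmxA mxE (bigD1 i) //= uB.1 mulr1 big1 ?addr0 // => k ki.
  have [->|/Udiag ik] := eqVneq (U i k) 0; first by rewrite mul0r.
  by rewrite ik eqxx in ki.
by rewrite -UB U1 mul1mx.
Qed.

Variable conj : 'I_N -> 'I_N.
Hypothesis conjK : involutive conj.
Hypothesis le_conj : forall i j, le i j -> le (conj j) (conj i).

(* A nonsingular matrix has a nonvanishing term in its determinant; composed with
   [conj] the corresponding permutation only goes down, so it is the identity. *)
Lemma conj_entry_neq0 (E : 'M[F]_N) : E \in unitmx -> (forall i j, E i j != 0 -> le j (conj i)) ->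
  forall i, E i (conj i) != 0.
Proof.
move=> uE Ele i.
have : \det E != 0 by rewrite -unitfE -unitmxE.
case/sum_neq0=> s; rewrite mulf_eq0 signr_eq0 /= => /prodf_neq0 Es.
pose t g := s (conj g).
have tle g : le (t g) g by rewrite -[X in le _ X]conjK; apply: Ele; apply: Es.
have rk_le g (_ : true) : (rk (t g) <= rk g ?= iff (rk (t g) == rk g))%N.
  split=> //; have [->//|ng] := eqVneq (t g) g; exact/ltnW/le_rk.
have : (\sum_g rk (t g) = \sum_g rk g)%N.
  by rewrite [RHS](reindex_inj (inj_comp (@perm_inj _ s) (inv_inj conjK))).
move/eqP; have [_ ->] := leqif_sum rk_le => /forallP/(_ (conj i))/= /eqP rki.
have ti : t (conj i) = conj i.
  apply/eqP/negPn/negP => nt; have := le_rk (tle _) nt; by rewrite rki ltnn.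
by rewrite -[X in E _ X]ti /t conjK; apply: Es.
Qed.

(* The rows of [A] are the [P_L] in power sums, [M] is the expansion of power sums in
   monomials, [W] is [Omega]; [X] below holds the monomial coefficients of [Omega Q_L]. *)
Lemma conjugate_duality A B (W D D' a b : 'rV[F]_N) (c : F) :
  (forall j, D 0 j != 0) -> (forall j, W 0 j != 0) -> (forall j, D' 0 j != 0) ->
  (forall j, W 0 j ^+ 2 * D' 0 j = c * D 0 j) ->
  unitriangular (A *m M^T) -> unitriangular (B *m M^T) ->
  A *m diag_mx D *m A^T = diag_mx a -> B *m diag_mx D' *m B^T = diag_mx b ->
  (forall i j, (M *m diag_mx (\row_k (W 0 k / D 0 k)) *m M^T) i j != 0 -> le j (conj i)) ->
  (forall i, (M *m diag_mx (\row_k (W 0 k / D 0 k)) *m M^T) i (conj i) != 0 ->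
     (M *m diag_mx (\row_k (W 0 k / D 0 k)) *m M^T) i (conj i) = 1) ->
  forall i j, W 0 j * A i j = c * (b 0 (conj i))^-1 * B (conj i) j.
Proof.
set E := M *m _ *m M^T => D0 W0 D'0 WD uA uB oA oB Ele E1 i j.
have [Au MTu] : A \in unitmx /\ M^T \in unitmx.
  by have := unitriangular_unit uA; rewrite unitmx_mul => /andP[].
have Bu : B \in unitmx by have := unitriangular_unit uB; rewrite unitmx_mul => /andP[].
have Mu : M \in unitmx by rewrite -unitmx_tr.
have diagu (d : 'rV[F]_N) : (forall k, d 0 k != 0) -> diag_mx d \in unitmx.
  by move=> h; rewrite unitmxE det_diag unitfE; apply/prodf_neq0 => k _.
have a0 : forall k, a 0 k != 0.
  by apply: diag_unit; rewrite -oA !unitmx_mul Au unitmx_tr Au diagu.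
have b0 : forall k, b 0 k != 0.
  by apply: diag_unit; rewrite -oB !unitmx_mul Bu unitmx_tr Bu diagu.
have Eu : E \in unitmx.
  by rewrite !unitmx_mul Mu MTu diagu // => k; rewrite mxE mulf_neq0 ?invr_neq0.
have {}E1 k : E k (conj k) = 1 by apply: E1; apply: conj_entry_neq0.
pose a' := map_mx GRing.inv a; pose D1 := map_mx GRing.inv D.
pose Y := diag_mx a' *m A *m diag_mx W; pose X := Y *m M^T; pose C := A *m M^T.
(* Orthogonality of the rows of [A] turned into completeness, with inverse norms as weights. *)
have AaA : A^T *m diag_mx a' *m A = diag_mx D1.
  have h : A *m (diag_mx D *m A^T *m diag_mx a') = 1%:M.
    by rewrite !mulmxA oA diag_inv.
  have := mulmx1C h; rewrite -!mulmxA => h2.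
  rewrite -[LHS]mul1mx -(mulmx1C (diag_inv D0)) -mulmxA -[in RHS](mulmx1 (diag_mx D1)).
  by congr (_ *m _); rewrite -h2 !mulmxA.
(* This is [h_k = sum_p C_(p,k) Q_p] after [Omega]: the rows of [E] are the [Omega h_k] and those of
   [X] the [Omega Q_p], in monomials. *)
have CX : C^T *m X = E.
  rewrite /C /X /Y trmx_mul trmxK !mulmxA -(mulmxA M) -(mulmxA M) AaA.
  rewrite /E -(mulmxA M (diag_mx D1)) mulmx_diag; congr (_ *m diag_mx _ *m _).
  by apply/rowP => k; rewrite !mxE mulrC.
have Xrec k l : X k l = E k l - \sum_(p | p != k) C p k * X p l.
  have CT p : C^T k p = C p k by rewrite [LHS]mxE.
  have -> : E k l = \sum_p C^T k p * X p l by rewrite -CX [LHS]mxE.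
  rewrite (bigD1 k) //= CT uA.1 mul1r.
  by under eq_bigr do rewrite CT; rewrite addrK.
have Xle : forall k l, X k l != 0 -> le l (conj k).
  apply: rk_ind_down => k IH l; rewrite Xrec => h.
  have [/eqP Ekl|] := boolP (E k l == 0); last exact: Ele.
  move: h; rewrite Ekl sub0r oppr_eq0 big_mkcond => /sum_neq0[p].
  case: ifPn => [pk|]; last by rewrite eqxx.
  rewrite mulf_eq0 negb_or => /andP[/(uA.2) kp Xpl].
  apply: (le_tr (IH p _ l Xpl)); last exact: le_conj.
  by apply: le_rk => //; rewrite eq_sym.
(* For [p] other than [k], a nonzero term would give [k <= p] from [C] and, after conjugating,
   [p <= k] from [X]. *)
have X1 k : X k (conj k) = 1.
  rewrite Xrec E1 big1 ?subr0 // => p pk; apply/eqP/negPn/negP.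
  rewrite mulf_eq0 negb_or => /andP[/(uA.2) kp /Xle/le_conj]; rewrite !conjK => pk'.
  by rewrite (le_antisym kp pk') eqxx in pk.
(* Renaming the rows by [conj] puts the leading monomial of each row on the diagonal. *)
pose Y' := \matrix_(g, l) Y (conj g) l.
have Y'M g l : (Y' *m M^T) g l = X (conj g) l.
  by rewrite !mxE; apply: eq_bigr => k _; rewrite !mxE.
have uY : unitriangular (Y' *m M^T).
  split=> [g|g l]; rewrite Y'M; first by rewrite -{2}(conjK g) X1.
  by move/Xle; rewrite conjK.
have YDY : Y *m diag_mx D' *m Y^T = diag_mx (c *: a').
  have -> : Y *m diag_mx D' *m Y^T =
      diag_mx a' *m (A *m (diag_mx W *m diag_mx D' *m diag_mx W) *m A^T) *m diag_mx a'.
    by rewrite /Y !trmx_mul !tr_diag_mx !mulmxA.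
  have -> : diag_mx W *m diag_mx D' *m diag_mx W = c *: diag_mx D.
    rewrite !mulmx_diag -linearZ; congr diag_mx; apply/rowP => k; rewrite !mxE.
    by rewrite -WD expr2 mulrAC.
  rewrite -scalemxAr -scalemxAl oA -scalemxAr -scalemxAl linearZ; congr (_ *: _).
  by rewrite (mulmx1C (diag_inv a0)) mul1mx.
have oY : Y' *m diag_mx D' *m Y'^T = diag_mx (\row_g (c * a' 0 (conj g))).
  apply/matrixP => g l; have /matrixP/(_ (conj g) (conj l)) := YDY.
  rewrite !mul_mx_diag !mxE (inj_eq (inv_inj conjK)) => h; rewrite -h.
  by apply: eq_bigr => k _; rewrite !mxE.
have YB : Y' = B by apply: (orthogonal_triangular_unique uY uB oY oB b0).
have bE : b 0 (conj i) = c / a 0 i.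
  have /matrixP/(_ (conj i) (conj i)) := oB.
  by rewrite -YB oY !mxE !eqxx conjK !mulr1n => <-.
have c0 : c != 0 by apply: contraNneq (b0 (conj i)) => c0; rewrite bE c0 mul0r.
rewrite bE -YB mxE conjK /Y mul_mx_diag mul_diag_mx !mxE.
have ai := a0 i; rewrite invfM invrK.
by field; rewrite c0 ai.
Qed.

End OrthogonalTriangular.

(** * Duality *)

Section Kernel.
Variables (F : fieldType) (q t : F).
Hypothesis char0 : forall n, n.+1%:R != 0 :> F.
Hypothesis q0 : q != 0.
Hypothesis t0 : t != 0.
Hypothesis q1 : forall x, (0 < x)%N -> 1 - q ^+ x != 0.
Hypothesis t1 : forall x, (0 < x)%N -> 1 - t ^+ x != 0.

Lemma prod_exp_sumn (a : F) s : \prod_(x <- s) a ^+ x = a ^+ sumn s.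
Proof. by rewrite sumnE prodrXr. Qed.

Lemma prod_seq_neq0 (f : nat -> F) s : all (fun x => 0 < x)%N s ->
  (forall x, (0 < x)%N -> f x != 0) -> \prod_(x <- s) f x != 0.
Proof.
move=> sp h; rewrite prodf_seq_neq0; apply: sub_all sp => x x0 /=; exact: h.
Qed.

Lemma ratio_neq0 x : (0 < x)%N -> (1 - q ^+ x) / (1 - t ^+ x) != 0.
Proof. by move=> x0; rewrite mulf_neq0 ?invr_neq0 ?q1 ?t1. Qed.

Lemma omfac_neq0 L : is_spart L -> omfac q t L != 0.
Proof.
case/and3P=> _ _ p2; rewrite /omfac mulf_neq0 //; last first.
  by apply: prod_seq_neq0 => // x x0; rewrite mulf_neq0 ?signr_eq0 ?ratio_neq0.
by rewrite prodf_seq_neq0; apply/allP => x _ /=; rewrite mulf_neq0 ?signr_eq0 ?expf_neq0.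
Qed.

Lemma zz_neq0 L : is_spart L -> zz q t L != 0.
Proof.
case/and3P=> _ _ p2; rewrite /zz !mulf_neq0 ?signr_eq0 ?expf_neq0 //.
  by apply: natr_neq0 => //; apply: zpart_gt0.
by apply: prod_seq_neq0 => // x x0; apply: ratio_neq0.
Qed.

(** All factors in [q] and [t] cancel, leaving the coefficients of the Cauchy identity up to a
    global sign. *)
Lemma omfac_zz L : is_spart L ->
  omfac q t L / zz q t L = (-1) ^+ 'C(size L.1, 2) * ((-1) ^+ sumn L.1 * pcoef F L.2).
Proof.
move=> Ls; have [_ _ p2] := and3P Ls; rewrite /omfac /zz /pcoef.
rewrite big_split [X in _ * X / _]big_split /= !prod_exp_sumn.
set r := \prod_(x <- L.2) (_ / _).
have r0 : r != 0 by apply: prod_seq_neq0 => // x x0; apply: ratio_neq0.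
have z0 : (zpart L.2)%:R != 0 :> F by apply: natr_neq0 => //; apply: zpart_gt0.
have qs : q ^+ sumn L.1 != 0 by rewrite expf_neq0.
have sgn : ((-1) ^+ 'C(size L.1, 2))^-1 = (-1) ^+ 'C(size L.1, 2) :> F by rewrite -exprVn invrN1.
rewrite !invfM sgn; move: ((-1) ^+ 'C(_, _)) ((-1) ^+ sumn _) (\prod_(_ <- _) _) => a b c.
move: (q ^+ _) (_%:R) z0 qs r r0 => d z z0 d0 r r0; field.
by rewrite z0 d0 r0.
Qed.

(** The source of [(q/t)^n]: a bosonic part [x] gives [(1 - t^-x) / (1 - q^-x) = (q/t)^x (1 - t^x) /
    (1 - q^x)], and a fermionic part [a] gives [q^(2a) t^(-a) = (q/t)^a q^a]. *)
Lemma omfac_sqr_zz L : is_spart L ->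
  omfac q t L ^+ 2 * zz t^-1 q^-1 L = (q / t) ^+ deg L * zz q t L.
Proof.
move=> Ls; have [_ _ p2] := and3P Ls.
have h : (\prod_(x <- L.2) ((-1) ^+ x.-1 * ((1 - q ^+ x) / (1 - t ^+ x)))) ^+ 2 *
    \prod_(x <- L.2) ((1 - t^-1 ^+ x) / (1 - q^-1 ^+ x)) =
    (q / t) ^+ sumn L.2 * \prod_(x <- L.2) ((1 - q ^+ x) / (1 - t ^+ x)).
  rewrite -prod_exp_sumn -prodrXl -!big_split !big_seq /=; apply: eq_bigr => x /(allP p2) x0.
  rewrite exprMn sqrr_sign mul1r !exprVn (expr_div_n q).
  have := q1 x0; have := t1 x0; have := expf_neq0 x q0; have := expf_neq0 x t0.
  move: (q ^+ x) (t ^+ x) => a b b0 a0 b1 a1; field.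
  by rewrite a0 b0 b1 -opprB oppr_eq0 a1.
rewrite /omfac /zz /deg exprD [X in (X * _) ^+ 2]big_split /= !prod_exp_sumn !exprMn.
rewrite sqrr_sign mul1r.
transitivity ((-1) ^+ 'C(size L.1, 2) * (zpart L.2)%:R * (q ^+ sumn L.1 ^+ 2 * t^-1 ^+ sumn L.1) *
  ((q / t) ^+ sumn L.2 * \prod_(x <- L.2) ((1 - q ^+ x) / (1 - t ^+ x)))).
  by rewrite -h; ring.
by rewrite exprMn; ring.
Qed.

Lemma signed_kernel n m O L : is_spart O -> is_spart L -> deg O = n -> deg L = n -> fdeg O = m -> fdeg L = m ->
  exists ml : (m <= size (entries O))%N, exists ml' : (m <= size (entries L))%N,
  \sum_(G <- sparts n m) (moncoef O G)%:~R * (omfac q t G / zz q t G) * (moncoef L G)%:~R =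
  (-1) ^+ 'C(m, 2) * \sum_(s : 'S_m) (-1) ^+ s * \sum_A (admissible ml ml' O L s A)%:R.
Proof.
move=> Os Ls dO dL fO fL.
have ml : (m <= size (entries O))%N by rewrite size_cat -fO leq_addr.
have ml' : (m <= size (entries L))%N by rewrite size_cat -fL leq_addr.
exists ml, ml'; rewrite -(kernel_coef ml ml' char0 Os dO fO fL erefl erefl) mulr_sumr.
rewrite !big_seq; apply: eq_bigr => G; rewrite mem_sparts => /and3P[Gs _ /eqP fG].
by rewrite omfac_zz // -[size G.1]/(fdeg G) fG; ring.
Qed.

Lemma kernel_support n m O L : O \in sparts n m -> L \in sparts n m ->
  \sum_(G <- sparts n m) (moncoef O G)%:~R * (omfac q t G / zz q t G) * (moncoef L G)%:~R != 0 ->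
  sle L (sconj O).
Proof.
rewrite !mem_sparts => /and3P[Os /eqP dO /eqP fO] /and3P[Ls /eqP dL /eqP fL].
have [ml [ml' ->]] := @signed_kernel n m O L Os Ls dO dL fO fL.
rewrite mulf_eq0 signr_eq0 /= => /sum_neq0[s].
rewrite mulf_eq0 signr_eq0 /= => /sum_neq0[A].
by case adm: admissible; rewrite ?eqxx // => _; apply: admissible_sle adm.
Qed.

(** A nonzero sum contains an admissible pair, which is then the only one; its permutation is the
    reversal, whose sign cancels the global one. Nonvanishing itself comes later from
    [conj_entry_neq0]. *)
Lemma kernel_conj n m O : O \in sparts n m ->
  let e := \sum_(G <- sparts n m)
    (moncoef O G)%:~R * (omfac q t G / zz q t G) * (moncoef (sconj O) G)%:~R in
  e != 0 -> e = 1.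
Proof.
rewrite mem_sparts => /and3P[Os /eqP dO /eqP fO] /=.
have fG : fdeg (sconj O) = m by rewrite fdeg_sconj.
have [|ml [ml' ->]] := @signed_kernel n m O (sconj O) Os (sconj_spart O) dO _ fO fG.
  by rewrite deg_sconj.
set S := \sum_s _ => h.
have {}h : S != 0 by apply: contraNneq h => ->; rewrite mulr0.
have [s] := sum_neq0 h; rewrite mulf_eq0 signr_eq0 /= => /sum_neq0[A].
case adm: admissible; rewrite ?eqxx // => _.
have ext := admissible_extremal Os fO erefl erefl.
have [es eA] := ext _ _ _ _ adm.
rewrite /S (bigD1 s) //= [X in _ + X]big1 ?addr0 => [|s' ns]; last first.
  rewrite big1 ?mulr0 // => A' _; case adm': admissible => //.
  by rewrite (ext _ _ _ _ adm').1 es eqxx in ns.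
rewrite (bigD1 A) //= adm big1 ?addr0 => [|A' nA]; last first.
  case adm': admissible => //.
  by rewrite (ext _ _ _ _ adm').2 -eA eqxx in nA.
by rewrite mulr1 es -[(-1) ^+ rev_perm m]signr_odd oddb odd_rev_perm signr_odd -expr2 sqrr_sign.
Qed.

End Kernel.

(** * A numerical rank compatible with dominance *)

Section SpartOrder.
Local Open Scope nat_scope.

(** Prefix sums of both shapes are constant from [deg L + fdeg L] on, so this finite range detects
    every difference. *)
Definition dom_rank (L : spart) :=
  \sum_(k < (deg L + fdeg L).+1) (\sum_(i < k) nth 0 (star L) i + \sum_(i < k) nth 0 (circ L) i).

Lemma sum_pref_all s k : all (fun x => 0 < x) s -> sumn s <= k ->
  \sum_(i < k) nth 0 s i = sumn s.
Proof.
move=> sp sk; have szk : size s <= k by apply: leq_trans (size_le_sumn sp) sk.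
rewrite -(big_mkord predT) (big_cat_nat (n := size s)) //= [X in _ + X]big_nat.
rewrite [X in _ + X]big1 ?addn0 => [|i /andP[si _]]; last by rewrite nth_default.
by rewrite [RHS]sumnE [RHS](big_nth 0).
Qed.

(** The rank is a sum of terms each monotone for dominance; equal ranks would make all prefix sums
    equal, hence the superpartitions too. *)
Lemma dom_rank_lt O L : is_spart O -> is_spart L -> deg O = deg L -> fdeg O = fdeg L ->
  sle O L -> O != L -> dom_rank O < dom_rank L.
Proof.
move=> Os Ls ed ef [h1 h2]; apply: contraNltn => le_rank; apply/eqP.
rewrite /dom_rank ed ef in le_rank.
set f := fun (L' : spart) k => \sum_(i < k) nth 0 (star L') i + \sum_(i < k) nth 0 (circ L') i.
have leif (k : 'I_(deg L + fdeg L).+1) (_ : true) : f O k <= f L k ?= iff (f O k == f L k).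
  by split=> //; apply: leq_add.
have eq_f k : k <= deg L + fdeg L -> f O k = f L k.
  move=> kB; have [h] := leqif_sum leif; rewrite eqn_leq h le_rank.
  by move/esym/forallP/(_ (Ordinal (kB : k < (deg L + fdeg L).+1)))/eqP.
have eq_pref_k k : k <= deg L + fdeg L ->
    \sum_(i < k) nth 0 (star L) i <= \sum_(i < k) nth 0 (star O) i /\
    \sum_(i < k) nth 0 (circ L) i <= \sum_(i < k) nth 0 (circ O) i.
  by move/eq_f; rewrite /f; have := h1 k; have := h2 k; lia.
apply: sle_anti => //; split=> k; case: (leqP k (deg L + fdeg L)) => kB.
- by have [] := eq_pref_k k kB.
- rewrite !sum_pref_all ?star_pos // !sumn_star; lia.
- by have [] := eq_pref_k k kB.
- rewrite !sum_pref_all ?circ_pos // !sumn_circ; lia.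
Qed.

End SpartOrder.

Section Duality.
Variables (F : fieldType) (q t : F).
Hypothesis char0 : forall n, n.+1%:R != 0 :> F.
Hypothesis q0 : q != 0.
Hypothesis t0 : t != 0.
Hypothesis q1 : forall x, (0 < x)%N -> 1 - q ^+ x != 0.
Hypothesis t1 : forall x, (0 < x)%N -> 1 - t ^+ x != 0.

Lemma inv_exp_neq1 (a : F) : a != 0 -> (forall x, (0 < x)%N -> 1 - a ^+ x != 0) ->
  forall x, (0 < x)%N -> 1 - a^-1 ^+ x != 0.
Proof.
move=> a0 a1 x x0; rewrite exprVn subr_eq0 eq_sym invr_eq1 eq_sym -subr_eq0.
exact: a1.
Qed.

Theorem macdonald_duality (P P' : spart -> spart -> F) :
  macdonald_family q t P -> macdonald_family t^-1 q^-1 P' ->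
  forall L O, is_spart L -> O \in sparts (deg L) (fdeg L) ->
    omega q t (P L) O =
    (q / t) ^+ deg L
    * (sprod t^-1 q^-1 (deg L) (fdeg L) (P' (sconj L)) (P' (sconj L)))^-1 * P' (sconj L) O.
Proof.
move=> [_ P1 Ple Porth] [_ P'1 P'le P'orth] L O Ls Oin.
set n := deg L; set m := fdeg L.
(* Numbering the finite component turns a family into a square matrix on the power-sum basis. *)
pose S := sparts n m; pose sp (i : 'I_(size S)) := tnth (in_tuple S) i.
have spS i : sp i \in S by apply: mem_tnth.
have spP i : [/\ is_spart (sp i), deg (sp i) = n & fdeg (sp i) = m].
  by have := spS i; rewrite mem_sparts => /and3P[? /eqP ? /eqP ?].
have sp_inj : injective sp by apply/tuple_uniqP/uniq_sparts.
have spE G : G \in S -> exists i, G = sp i by move=> /(@tnthP _ _ (in_tuple S)).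
have sumS (f : spart -> F) : \sum_(G <- S) f G = \sum_i f (sp i) by rewrite big_tnth.
have [conj spconj] : exists conj, forall i, sp (conj i) = sconj (sp i).
  apply: (@fin_all_exists _ _ (fun i j => sp j = sconj (sp i))) => i.
  have [si di fi] := spP i.
  have [|j ->] := spE (sconj (sp i)); last by exists j.
  by rewrite mem_sparts sconj_spart deg_sconj // fdeg_sconj // di fi !eqxx.
pose le i j := sle (sp i) (sp j).
pose M := \matrix_(i, j) ((moncoef (sp i) (sp j))%:~R : F).
pose coords (Q : spart -> spart -> F) := \matrix_(i, j) Q (sp i) (sp j).
have mcoefE Q i j : (coords Q *m M^T) i j = mcoef (sp j) (Q (sp i)).
  have [_ dj fj] := spP j; rewrite /mcoef dj fj -/S sumS mxE.
  by apply: eq_bigr => k _; rewrite !mxE.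
have unitri Q : (forall L, is_spart L -> mcoef L (Q L) = 1) ->
    (forall L O, is_spart L -> is_spart O -> mcoef O (Q L) != 0 -> O = L \/ sdlt O L) ->
    unitriangular le (coords Q *m M^T).
  move=> Q1 Qle; split=> [i|i j]; rewrite mcoefE; first by apply: Q1; have [] := spP i.
  have [si _ _] := spP i; have [sj _ _] := spP j.
  by case/(Qle _ _ si sj) => [e|[[_ _ h1 h2] _]]; rewrite /le ?e; split=> // k.
have orth Q a b : (forall L O, is_spart L -> is_spart O -> L <> O -> deg L = deg O ->
      fdeg L = fdeg O -> sprod a b (deg L) (fdeg L) (Q L) (Q O) = 0) ->
    coords Q *m diag_mx (\row_k zz a b (sp k)) *m (coords Q)^T =
    diag_mx (\row_i sprod a b n m (Q (sp i)) (Q (sp i))).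
  move=> Qorth; apply/matrixP => i j.
  have -> : (coords Q *m diag_mx (\row_k zz a b (sp k)) *m (coords Q)^T) i j =
      sprod a b n m (Q (sp i)) (Q (sp j)).
    rewrite /sprod -/S sumS mul_mx_diag mxE; apply: eq_bigr => k _.
    by rewrite !mxE mulrAC.
  rewrite !mxE; case: (i =P j) => [->|nij]; rewrite ?mulr1n ?mulr0n //.
  have [si di fi] := spP i; have [sj dj fj] := spP j.
  rewrite -di -fi Qorth ?di ?fi ?dj ?fj // => /sp_inj; exact: nij.
have [iL eL] : exists i, L = sp i by apply: spE; rewrite mem_sparts Ls !eqxx.
have [iO eO] := spE O Oin.
have kerE i j : (M *m diag_mx (\row_k ((\row_k' omfac q t (sp k')) 0 k /
      (\row_k' zz q t (sp k')) 0 k)) *m M^T) i j =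
    \sum_(G <- S) (moncoef (sp i) G)%:~R * (omfac q t G / zz q t G) * (moncoef (sp j) G)%:~R.
  by rewrite sumS mul_mx_diag mxE; apply: eq_bigr => k _; rewrite !mxE.
have := @conjugate_duality F _ le (fun i => dom_rank (sp i)) _ _ M conj _ _ (coords P) (coords P')
  (\row_k omfac q t (sp k)) (\row_k zz q t (sp k)) (\row_k zz t^-1 q^-1 (sp k)) _ _
  ((q / t) ^+ n) _ _ _ _ (unitri P P1 Ple) (unitri P' P'1 P'le) (orth P _ _ Porth)
  (orth P' _ _ P'orth) _ _ iL iO.
rewrite !mxE spconj -eL -eO; apply.
- move=> i j ij nij; have [si di fi] := spP i; have [sj dj fj] := spP j.
  by apply: dom_rank_lt; rewrite ?di ?fi ?dj ?fj // (inj_eq sp_inj).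
- by move=> j i k; apply: sle_trans.
- by move=> i; apply: sp_inj; rewrite !spconj sconjK //; have [] := spP i.
- move=> i j ij; have [si di fi] := spP i; have [sj dj fj] := spP j.
  by rewrite /le !spconj; apply: sle_sconj; rewrite ?di ?dj ?fi ?fj.
- by move=> j; rewrite mxE zz_neq0 //; have [] := spP j.
- by move=> j; rewrite mxE omfac_neq0 //; have [] := spP j.
- move=> j; rewrite mxE zz_neq0 ?invr_eq0 //; try exact: inv_exp_neq1; by have [] := spP j.
- by move=> j; have [sj dj _] := spP j; rewrite !mxE omfac_sqr_zz // dj.
- by move=> i j; rewrite kerE /le spconj; apply: kernel_support.
- by move=> i; rewrite kerE spconj; apply: kernel_conj.
Qed.

End Duality.

(** * Specialisation to rational functions in [q] and [t] *)

Lemma QQqt_char0 n : n.+1%:R != 0 :> QQqt.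
Proof.
rewrite -(rmorph_nat (@tofrac {poly {poly rat}})) tofrac_eq0.
by rewrite -(rmorph_nat (@polyC {poly rat})) polyC_eq0 -(rmorph_nat (@polyC rat)) polyC_eq0 pnatr_eq0.
Qed.

Lemma polyX_exp_neq1 (R : idomainType) x : (0 < x)%N -> 1 - 'X^x != 0 :> {poly R}.
Proof.
move=> x0; apply/eqP => /(congr1 (fun p : {poly R} => p`_x)).
by rewrite coefB coef1 coefXn coef0 eqxx eqn0Ngt x0 sub0r => /eqP; rewrite oppr_eq0 oner_eq0.
Qed.

Lemma qq_neq0 : qq != 0.
Proof. by rewrite tofrac_eq0 polyC_eq0 polyX_eq0. Qed.

Lemma tt_neq0 : tt != 0.
Proof. by rewrite tofrac_eq0 polyX_eq0. Qed.

Lemma qq_exp_neq1 x : (0 < x)%N -> 1 - qq ^+ x != 0.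
Proof.
move=> x0; rewrite -tofracXn -tofrac1 -tofracB tofrac_eq0.
by rewrite -polyC_exp -polyC1 -polyCB polyC_eq0 polyX_exp_neq1.
Qed.

Lemma tt_exp_neq1 x : (0 < x)%N -> 1 - tt ^+ x != 0.
Proof. by move=> x0; rewrite -tofracXn -tofrac1 -tofracB tofrac_eq0 polyX_exp_neq1. Qed.

Theorem theorem5p7 (P P' : spart -> spart -> QQqt) :
  macdonald_family qq tt P ->
  macdonald_family tt^-1 qq^-1 P' ->
  forall L G : spart, is_spart L -> is_spart G ->
    circ G = conjp (circ L) -> star G = conjp (star L) ->
    forall O : spart,
      omega qq tt (P L) O =
      (qq / tt) ^+ deg L
      * (sprod tt^-1 qq^-1 (deg G) (fdeg G) (P' G) (P' G))^-1 * P' G O.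
Proof.
move=> mP mP' L G Ls Gs ec es O.
have eG := sconj_unique Ls Gs ec es; have dG := deg_sconj Ls; have fG := fdeg_sconj Ls.
(* Outside the component of [L] both sides vanish, since conjugation preserves both degrees. *)
have [Oin|nO] := boolP (O \in sparts (deg L) (fdeg L)); last first.
  have [P0 _ _ _] := mP; have [P'0 _ _ _] := mP'.
  by rewrite /omega P0 // P'0 ?mulr0 // eG dG fG.
rewrite eG dG fG; apply: (macdonald_duality _ _ _ _ _ mP mP') => //.
- exact: QQqt_char0.
- exact: qq_neq0.
- exact: tt_neq0.
- exact: qq_exp_neq1.
- exact: tt_exp_neq1.
Qed.
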